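(* For every $r>1$, let $d=\frac12(r+1)$, let $$Q_r=1\oplus0\oplus\begin{pmatrix}D_0&-\ell(D_0)\\\ell(D_0)&I_0-D_0\end{pmatrix},$$ where $I_0,D_0,\ell(D_0)\in C[1,d]$ are given by $I_0(t)=1$, $D_0(t)=t$, $\ell(D_0)(t)=\sqrt{t(t-1)}$, regarded as an idempotent operator on the Hilbert space $\mathbb{C}\oplus\mathbb{C}\oplus L^2[1,d]\oplus L^2[1,d]$, and let $T_{Q_r}=m(Q_r)+m(Q_r)Q_r$. Then $$W(T_{Q_r})=\Big\{x+iy:\ x,y\in\mathbb{R},\ \frac{\big(x-\frac{r+3}{4}\big)^2}{(r^2+3r+4)/8}+\frac{y^2}{(r^2-1)/16}<1\Big\}.$$
   Context: Each $f\in C[1,d]$ (complex-valued continuous functions) is identified with the multiplication operator $g\mapsto fg$ on $L^2[1,d]$ (Lebesgue measure), so that elements of $\mathbb{C}\oplus\{0\}\oplus M_2(C[1,d])$ act on $\mathbb{C}\oplus\mathbb{C}\oplus L^2[1,d]\oplus L^2[1,d]$, the second summand $0$ being the zero operator on the second copy of $\mathbb{C}$. For an idempotent $Q$ (i.e. $Q^2=Q$) on a Hilbert space, the matched projection is $m(Q)=\frac12(|Q^*|+Q^* )|Q^*|^\dag(|Q^*|+I)^{-1}(|Q^*|+Q)$, where $|T|=(T^*T)^{1/2}$ and $T^\dag$ is the Moore-Penrose inverse of a closed-range operator $T$ (the unique $X$ with $TXT=T$, $XTX=X$, $(TX)^*=TX$, $(XT)^*=XT$). The numerical range is $W(T)=\{\langle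 Tx,x\rangle:\|x\|=1\}$. *)

(* Defs.v *)
From HB Require Import structures.
From mathcomp Require Import all_boot all_order all_algebra.
From mathcomp Require Import all_classical all_reals all_analysis.
From mathcomp Require Import measurable_realfun complex sesquilinear ring.

Set Implicit Arguments.
Unset Strict Implicit.
Unset Printing Implicit Defensive.
Import Order.TTheory GRing.Theory Num.Theory.
Import numFieldNormedType.Exports.

Local Open Scope classical_set_scope.
Local Open Scope ring_scope.
Local Open Scope complex_scope.
Local Open Scope quotient_scope.

(* Operators are everywhere defined functions H -> H and the inner product is
   linear in its first argument. Operators characterized by a property (adjoint,
   positive square root, Moore-Penrose inverse, inverse) are selected with xget
   and default to 0 when no bounded operator has the property. *)
Section Operators.
Context {C : numClosedFieldType} {H : lmodType C} (ip : {dot H for @Num.conj C}).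
Implicit Types (S T X Q : H -> H).

Definition hnorm (x : H) : C := sqrtC (ip x x).

Definition bounded_op T :=
  linear T /\ exists M : C, forall x, hnorm (T x) <= M * hnorm x.

Definition is_adjoint T S := forall x y, ip (T x) y = ip x (S y).

Definition adjoint T : H -> H :=
  xget 0 [set S | bounded_op S /\ is_adjoint T S].

Definition positive_op T := bounded_op T /\ forall x, 0 <= ip (T x) x.

Definition op_sqrt T : H -> H :=
  xget 0 [set S | positive_op S /\ S \o S = T].

Definition op_abs T : H -> H := op_sqrt (adjoint T \o T).

Definition is_mp_inverse T X :=
  [/\ T \o X \o T = T, X \o T \o X = X,
      is_adjoint (T \o X) (T \o X) & is_adjoint (X \o T) (X \o T)].

Definition mp_inverse T : H -> H :=
  xget 0 [set X | bounded_op X /\ is_mp_inverse T X].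

Definition op_inv T : H -> H :=
  xget 0 [set X | [/\ bounded_op X, T \o X = id & X \o T = id]].

Definition matched_projection Q : H -> H :=
  let A := op_abs (adjoint Q) in
  2^-1 *: ((A + adjoint Q) \o mp_inverse A \o op_inv (A + id) \o (A + Q)).

Definition numerical_range T : set C :=
  [set ip (T x) x | x in [set x | hnorm x = 1]].

End Operators.

(* The library has only real-valued L^p functions, and its quotient type
   LspaceType carries no vector space structure. *)
Section ComplexL2.
Context d (T : measurableType d) (R : realType) (mu : {measure set T -> \bar R}).
Implicit Types (f g h : T -> R[i]).

Definition sqintegrable : pred (T -> R[i]) := fun f =>
  ((@complex.Re R \o f) \in Lfun mu 2%:E) && ((@complex.Im R \o f) \in Lfun mu 2%:E).

Record L2fun := MkL2fun { L2fun_val :> T -> R[i]; _ : sqintegrable L2fun_val }.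
HB.instance Definition _ := [isSub of L2fun for L2fun_val].
HB.instance Definition _ := gen_eqMixin L2fun.
HB.instance Definition _ := gen_choiceMixin L2fun.

Definition ae_eq_L2 (f g : L2fun) : bool := `[< {ae mu, forall t, f t = g t} >].

Fact ae_eq_L2_equiv : equiv_class_of ae_eq_L2.
Proof.
split=> [f|f g|g f h].
- by apply/asboolP; exact: aeW.
- by apply/asboolP/asboolP; apply: filterS => t ->.
- by move=> /asboolP fg /asboolP gh; apply/asboolP; apply: filterS2 fg gh => t -> ->.
Qed.
Canonical ae_eq_L2_equivRel := EquivRelPack ae_eq_L2_equiv.

Definition L2 : Type := {eq_quot ae_eq_L2}.
HB.instance Definition _ := Choice.on L2.
HB.instance Definition _ := EqQuotient.on L2.

Definition L2repr (u : L2) : L2fun := repr u.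
Coercion L2repr : L2 >-> L2fun.
Implicit Types (u v w : L2).

Let Lfun2_submod : submod_closed (Lfun mu 2%:E).
Proof. exact: (@Lfun_submod_closed _ T R mu _ (lee1n 2)). Qed.

Fact sqintegrable0 : sqintegrable (fun=> 0).
Proof. by apply/andP; split; exact: Lfun2_submod.1. Qed.

(* The class of h; the zero class when h is not square integrable. *)
Definition toL2 h : L2 := \pi_L2 (insubd (MkL2fun sqintegrable0) h).

Lemma toL2K h : sqintegrable h -> {ae mu, forall t, toL2 h t = h t}.
Proof.
move=> hi; rewrite /toL2 /L2repr.
have hE : insubd (MkL2fun sqintegrable0) h = h :> (T -> R[i]) by rewrite insubdK.
by case: piP => k /eqmodP/asboolP; apply: filterS => t; rewrite hE => ->.
Qed.

Lemma L2P u v : {ae mu, forall t, u t = v t} <-> u = v.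
Proof.
split=> [uv|->]; last exact: aeW.
by rewrite -[u]reprK -[v]reprK; apply/eqmodP/asboolP.
Qed.

Lemma L2_sqintegrable u : sqintegrable u.
Proof. by rewrite /L2repr; case: (repr u). Qed.

Let Lfun2D (x y : T -> R) : x \in Lfun mu 2%:E -> y \in Lfun mu 2%:E ->
  (fun t => x t + y t) \in Lfun mu 2%:E.
Proof.
move=> hx hy; have [_ /(_ 1 x y hx hy)] := Lfun2_submod.
by rewrite scale1r.
Qed.

Let Lfun2Z (a : R) (x : T -> R) : x \in Lfun mu 2%:E ->
  (fun t => a * x t) \in Lfun mu 2%:E.
Proof.
move=> hx; have [h0 /(_ a x 0 hx h0)] := Lfun2_submod.
by rewrite addr0.
Qed.

Lemma sqintegrableD f g : sqintegrable f -> sqintegrable g ->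
  sqintegrable (fun t => f t + g t).
Proof.
move=> /andP[fr fi] /andP[gr gi]; apply/andP; split.
- rewrite [X in X \in _](_ : _ = fun t => complex.Re (f t) + complex.Re (g t)).
    exact: Lfun2D.
  by apply/funext => t /=; case: (f t) (g t) => [? ?] [? ?].
- rewrite [X in X \in _](_ : _ = fun t => complex.Im (f t) + complex.Im (g t)).
    exact: Lfun2D.
  by apply/funext => t /=; case: (f t) (g t) => [? ?] [? ?].
Qed.

Lemma sqintegrableZ (a : R[i]) f : sqintegrable f -> sqintegrable (fun t => a * f t).
Proof.
move=> /andP[fr fi]; apply/andP; split.
- rewrite [X in X \in _](_ : _ = fun t => complex.Re a * complex.Re (f t) +
    - complex.Im a * complex.Im (f t)).
    by apply: Lfun2D; exact: Lfun2Z.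
  by apply/funext => t /=; case: a (f t) => [? ?] [? ?] /=; rewrite mulNr.
- rewrite [X in X \in _](_ : _ = fun t => complex.Re a * complex.Im (f t) +
    complex.Im a * complex.Re (f t)).
    by apply: Lfun2D; exact: Lfun2Z.
  by apply/funext => t /=; case: a (f t) => [? ?] [? ?].
Qed.

Lemma sqintegrableN f : sqintegrable f -> sqintegrable (fun t => - f t).
Proof.
move=> /(sqintegrableZ (-1)).
by under eq_fun do rewrite mulN1r.
Qed.

Definition L2zero : L2 := toL2 (fun=> 0).
Definition L2opp u : L2 := toL2 (fun t => - u t).
Definition L2add u v : L2 := toL2 (fun t => u t + v t).
Definition L2scale (a : R[i]) u : L2 := toL2 (fun t => a * u t).

Let L2zeroE : {ae mu, forall t, L2zero t = 0}.
Proof. exact: toL2K sqintegrable0. Qed.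
Let L2oppE u : {ae mu, forall t, L2opp u t = - u t}.
Proof. by apply: toL2K; apply: sqintegrableN; exact: L2_sqintegrable. Qed.
Let L2addE u v : {ae mu, forall t, L2add u v t = u t + v t}.
Proof. by apply: toL2K; apply: sqintegrableD; exact: L2_sqintegrable. Qed.
Let L2scaleE a u : {ae mu, forall t, L2scale a u t = a * u t}.
Proof. by apply: toL2K; apply: sqintegrableZ; exact: L2_sqintegrable. Qed.

Fact L2addA : associative L2add.
Proof.
move=> u v w; apply/L2P.
apply: filterS2 (filterI (L2addE u (L2add v w)) (L2addE v w))
  (filterI (L2addE (L2add u v) w) (L2addE u v)) => t [-> ->] [-> ->].
by rewrite addrA.
Qed.
Fact L2addC : commutative L2add.
Proof.
move=> u v; apply/L2P.
by apply: filterS2 (L2addE u v) (L2addE v u) => t -> ->; rewrite addrC.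
Qed.
Fact L2add0 : left_id L2zero L2add.
Proof.
move=> u; apply/L2P.
by apply: filterS2 (L2addE L2zero u) L2zeroE => t -> ->; rewrite add0r.
Qed.
Fact L2addN : left_inverse L2zero L2opp L2add.
Proof.
move=> u; apply/L2P.
apply: filterS3 (L2addE (L2opp u) u) (L2oppE u) L2zeroE => t -> -> ->.
by rewrite addNr.
Qed.
HB.instance Definition _ := GRing.isZmodule.Build L2 L2addA L2addC L2add0 L2addN.

Lemma L2_0E : {ae mu, forall t, (0 : L2) t = 0}.
Proof. exact: L2zeroE. Qed.
Lemma L2_DE u v : {ae mu, forall t, (u + v : L2) t = u t + v t}.
Proof. exact: L2addE. Qed.
Lemma L2_NE u : {ae mu, forall t, (- u : L2) t = - u t}.
Proof. exact: L2oppE. Qed.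

Fact L2scaleA a b u : L2scale a (L2scale b u) = L2scale (a * b) u.
Proof.
apply/L2P; apply: filterS3 (L2scaleE a (L2scale b u)) (L2scaleE b u)
  (L2scaleE (a * b) u) => t -> -> ->.
by rewrite mulrA.
Qed.
Fact L2scale1 : left_id 1 L2scale.
Proof.
by move=> u; apply/L2P; apply: filterS (L2scaleE 1 u) => t ->; rewrite mul1r.
Qed.
Fact L2scaleDr : right_distributive L2scale +%R.
Proof.
move=> a u v; apply/L2P.
apply: filterS3 (filterI (L2scaleE a (u + v)) (L2_DE u v))
  (L2_DE (L2scale a u) (L2scale a v)) (filterI (L2scaleE a u) (L2scaleE a v)).
by move=> t [-> ->] -> [-> ->]; rewrite mulrDr.
Qed.
Fact L2scaleDl u : {morph L2scale^~ u : a b / a + b}.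
Proof.
move=> a b; apply/L2P.
apply: filterS3 (L2scaleE (a + b) u)
  (L2_DE (L2scale a u) (L2scale b u)) (filterI (L2scaleE a u) (L2scaleE b u)).
by move=> t -> -> [-> ->]; rewrite mulrDl.
Qed.
HB.instance Definition _ := GRing.Zmodule_isLmodule.Build R[i] L2
  L2scaleA L2scale1 L2scaleDr L2scaleDl.

Lemma L2_ZE a u : {ae mu, forall t, (a *: u : L2) t = a * u t}.
Proof. exact: L2scaleE. Qed.

Definition Cintegral h : R[i] :=
  (\int[mu]_t complex.Re (h t)) +i* (\int[mu]_t complex.Im (h t)).

Definition Cintegrable h :=
  mu.-integrable setT (fun t => (complex.Re (h t))%:E) /\
  mu.-integrable setT (fun t => (complex.Im (h t))%:E).

Let Re_lin (a x y : R[i]) : complex.Re (a * x + y) =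
  complex.Re a * complex.Re x + - complex.Im a * complex.Im x + complex.Re y.
Proof. by case: a x y => [? ?] [? ?] [? ?] /=; rewrite mulNr. Qed.
Let Im_lin (a x y : R[i]) : complex.Im (a * x + y) =
  complex.Re a * complex.Im x + complex.Im a * complex.Re x + complex.Im y.
Proof. by case: a x y => [? ?] [? ?] [? ?]. Qed.

Let RintegralP (a b : R) (x y z : T -> R) :
  mu.-integrable setT (EFin \o x) -> mu.-integrable setT (EFin \o y) ->
  mu.-integrable setT (EFin \o z) ->
  mu.-integrable setT (fun t => (a * x t + b * y t + z t)%:E) /\
  \int[mu]_t (a * x t + b * y t + z t) =
  a * \int[mu]_t x t + b * \int[mu]_t y t + \int[mu]_t z t.
Proof.
move=> ix iy iz.
have iax : mu.-integrable setT (fun t => (a * x t)%:E).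
  by under eq_fun do rewrite EFinM; exact: integrableZl.
have iby : mu.-integrable setT (fun t => (b * y t)%:E).
  by under eq_fun do rewrite EFinM; exact: integrableZl.
have iab : mu.-integrable setT (fun t => (a * x t + b * y t)%:E).
  by under eq_fun do rewrite EFinD; exact: integrableD.
split; first by under eq_fun do rewrite EFinD; exact: integrableD.
by rewrite RintegralD// RintegralD// !RintegralZl.
Qed.

Lemma CintegralP (a : R[i]) f g : Cintegrable f -> Cintegrable g ->
  Cintegrable (fun t => a * f t + g t) /\
  Cintegral (fun t => a * f t + g t) = a * Cintegral f + Cintegral g.
Proof.
move=> [fr fi] [gr gi].
have [i1 e1] := RintegralP (complex.Re a) (- complex.Im a) fr fi gr.
have [i2 e2] := RintegralP (complex.Re a) (complex.Im a) fi fr gi.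
split.
  split.
    by under eq_fun do rewrite Re_lin.
  by under eq_fun do rewrite Im_lin.
apply/eqP; rewrite eq_complex Re_lin Im_lin /Cintegral /= -e1 -e2.
by apply/andP; split; apply/eqP; apply: eq_Rintegral => t _;
  rewrite -?Re_lin -?Im_lin.
Qed.

Lemma Cintegral_conj f : Cintegrable f ->
  Cintegral (fun t => (f t)^*%R) = (Cintegral f)^*%R.
Proof.
move=> [fr fi]; rewrite /Cintegral.
congr (_ +i* _).
  by apply: eq_Rintegral => t _; case: (f t).
transitivity (\int[mu]_t (-1 * complex.Im (f t))).
  by apply: eq_Rintegral => t _; rewrite mulN1r; case: (f t).
by rewrite RintegralZl// mulN1r.
Qed.

Lemma ae_eq_Cintegral f g : Cintegrable f -> Cintegrable g ->
  {ae mu, forall t, f t = g t} -> Cintegral f = Cintegral g.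
Proof.
move=> [/measurable_int fr /measurable_int fi] [/measurable_int gr /measurable_int gi] fg.
congr (fine _ +i* fine _); apply: ae_eq_integral => //;
  by apply: filterS fg => t /= -> _.
Qed.

Lemma sqintegrable_mul f g : sqintegrable f -> sqintegrable g ->
  Cintegrable (fun t => f t * (g t)^*%R).
Proof.
move=> /andP[fr fi] /andP[gr gi]; split.
  rewrite (_ : (fun t => _) = (fun t => (complex.Re (f t) * complex.Re (g t))%:E +
    (complex.Im (f t) * complex.Im (g t))%:E)%E).
    apply: integrableD => //.
      by apply/Lfun1_integrable; exact: (Lfun2_mul_Lfun1 fr gr).
    by apply/Lfun1_integrable; exact: (Lfun2_mul_Lfun1 fi gi).
  apply/funext => t; rewrite -EFinD; congr EFin.
  by case: (f t) (g t) => [? ?] [? ?] /=; rewrite mulrN opprK.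
rewrite (_ : (fun t => _) = (fun t => (complex.Im (f t) * complex.Re (g t))%:E -
    (complex.Re (f t) * complex.Im (g t))%:E)%E).
  apply: integrableB => //.
    by apply/Lfun1_integrable; exact: (Lfun2_mul_Lfun1 fi gr).
  by apply/Lfun1_integrable; exact: (Lfun2_mul_Lfun1 fr gi).
apply/funext => t; rewrite -EFinB; congr EFin.
by case: (f t) (g t) => [? ?] [? ?] /=; rewrite mulrN addrC.
Qed.

Definition L2dot u v : R[i] := Cintegral (fun t => u t * (v t)^*%R).

Fact L2dot_linear v a u w : L2dot (a *: u + w) v = a * L2dot u v + L2dot w v.
Proof.
have iu := sqintegrable_mul (L2_sqintegrable u) (L2_sqintegrable v).
have iw := sqintegrable_mul (L2_sqintegrable w) (L2_sqintegrable v).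
have [iuw <-] := CintegralP a iu iw.
apply: ae_eq_Cintegral => //.
  by apply: sqintegrable_mul; exact: L2_sqintegrable.
apply: filterS2 (L2_DE (a *: u) w) (L2_ZE a u) => t -> ->.
by rewrite mulrDl mulrA.
Qed.

Fact L2dot_hermitian u v : L2dot u v = (L2dot v u)^*%R.
Proof.
rewrite -Cintegral_conj; last first.
  by apply: sqintegrable_mul; exact: L2_sqintegrable.
congr Cintegral; apply/funext => t.
by rewrite rmorphM/= conjCK mulrC.
Qed.

Fact L2dot_gt0 u : u != 0 -> 0 < L2dot u u.
Proof.
pose q t := complex.Re (u t) ^+ 2 + complex.Im (u t) ^+ 2.
have qE t : u t * (u t)^*%R = q t +i* 0.
  rewrite /q; case: (u t) => a b; apply/eqP; rewrite eq_complex /=.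
  by rewrite !mulrN opprK -!expr2 [b * a]mulrC addNr !eqxx.
have [iq _] := sqintegrable_mul (L2_sqintegrable u) (L2_sqintegrable u).
have {}iq : mu.-integrable setT (EFin \o q).
  by move: iq; under eq_fun do rewrite qE.
have q0 t : 0 <= q t by rewrite addr_ge0 ?sqr_ge0.
have -> : L2dot u u = (\int[mu]_t q t) +i* 0.
  rewrite /L2dot; congr (_ +i* _).
    by apply: eq_Rintegral => t _; rewrite qE.
  rewrite /Rintegral (_ : (fun t => _) = cst 0%E) ?integral_cst ?mul0e//.
  by apply/funext => t; rewrite qE.
rewrite ltcE/= eqxx/= lt_neqAle Rintegral_ge0// andbT; apply: contra_neq.
move=> /esym/eqP; rewrite /Rintegral fine_eq0 ?integrable_fin_num// => /eqP iq0.
apply/L2P.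
have : ae_eq mu setT (EFin \o q) (cst 0%E).
  apply/ae_eq_integral_abs => //; first exact: measurable_int iq.
  by under eq_integral => t _ do rewrite gee0_abs ?lee_fin//.
apply: filterS2 L2_0E => t -> /(_ I) /= [/eqP].
rewrite paddr_eq0 ?sqr_ge0// !sqrf_eq0 => ut0.
by apply/eqP; rewrite eq_complex.
Qed.

Let L2dot_bilinear : bilinear_for
  (GRing.Scale.Law.clone _ _ *%R _) (GRing.Scale.Law.clone _ _ (@Num.conj R[i] \; *%R) _) L2dot.
Proof.
split=> [v a u w|u a v w] /=; first exact: L2dot_linear.
rewrite L2dot_hermitian L2dot_linear rmorphD rmorphM/=.
by rewrite -!L2dot_hermitian.
Qed.
HB.instance Definition _ := bilinear_isBilinear.Build R[i] L2 L2 R[i] _ _ L2dot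
  L2dot_bilinear.
Let L2dot_herm u v : L2dot u v = (-1) ^+ false * Num.conj (L2dot v u).
Proof. by rewrite expr0 mul1r -L2dot_hermitian. Qed.
HB.instance Definition _ := isHermitianSesquilinear.Build R[i] L2 false Num.conj
  L2dot L2dot_herm.
HB.instance Definition _ := isDotProduct.Build R[i] L2 L2dot L2dot_gt0.

Lemma sqintegrable_bounded (M : R) (b : T -> R) (x : T -> R) :
  measurable_fun setT b -> (forall t, `|b t| <= M) -> x \in Lfun mu 2%:E ->
  (fun t => b t * x t) \in Lfun mu 2%:E.
Proof.
move=> mb bM hx.
have := Lfun2Z M hx.
move: hx; rewrite !inE/= => /andP[/[!inE]/= mx _] /andP[/[!inE]/= mMx fMx].
apply/andP; rewrite !inE/=; split; first exact: measurable_funM.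
apply: le_lt_trans fMx; rewrite unlock /Lnorm.
have mpow (y : T -> R) : measurable_fun setT y ->
    measurable_fun setT (fun t => (`|(EFin \o y) t| `^ 2)%E).
  move=> my; apply/measurable_EFinP.
  apply: (@measurableT_comp _ _ _ _ _ _ (fun z : R => z `^ 2)%R) => //.
  exact/measurableT_comp.
apply: gt0_ler_poweR.
- by [].
- by rewrite in_itv/= leey integral_ge0// => t _; rewrite poweR_ge0.
- by rewrite in_itv/= leey integral_ge0// => t _; rewrite poweR_ge0.
- apply: ge0_le_integral => //.
  + by move=> t _; rewrite poweR_ge0.
  + by apply: mpow; exact: measurable_funM.
  + exact: mpow.
  + move=> t _ /=; rewrite lee_fin ge0_ler_powR ?nnegrE// !normrM.
    by rewrite ler_wpM2r// (le_trans (bM t))// ler_norm.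
Qed.
Lemma sqintegrableM_bounded (M N : R) (p q : T -> R) f :
  measurable_fun setT p -> (forall t, `|p t| <= M) ->
  measurable_fun setT q -> (forall t, `|q t| <= N) ->
  sqintegrable f -> sqintegrable (fun t => (p t +i* q t) * f t).
Proof.
move=> mp bp mq bq /andP[fr fi]; apply/andP; split.
- rewrite [X in X \in _](_ : _ = fun t => p t * complex.Re (f t) +
    -1 * (q t * complex.Im (f t))).
    apply: Lfun2D; first exact: sqintegrable_bounded bp fr.
    by apply: Lfun2Z; exact: sqintegrable_bounded bq fi.
  by apply/funext => t /=; case: (f t) => x y /=; rewrite mulN1r.
- rewrite [X in X \in _](_ : _ = fun t => p t * complex.Im (f t) +
    q t * complex.Re (f t)).
    apply: Lfun2D; first exact: sqintegrable_bounded bp fi.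
    exact: sqintegrable_bounded bq fr.
  by apply/funext => t /=; case: (f t) => x y.
Qed.

End ComplexL2.

Section Interval.
Context {R : realType}.

(* Lebesgue measure on [a, b], carried by the whole line: a function is only
   determined on [a, b], almost everywhere. *)
Definition leb_itv (a b : R) : {measure set (measurableTypeR R) -> \bar R} :=
  mrestr (@lebesgue_measure R) (measurable_itv `[a, b]).

Local Notation L2itv a b := (L2 (leb_itv a b)).

Definition continuous_on (a b : R) (phi : R -> R[i]) :=
  {within `[a, b], continuous (phi : R -> R[i]^o)}.

(* phi is cut off outside [a, b] because a function which is continuous on
   [a, b] need not be measurable elsewhere; mulopE below shows that the cut-off
   and the default value in toL2 are harmless. *)
Definition mulop (a b : R) (phi : R -> R[i]) (u : L2itv a b) : L2itv a b :=
  toL2 (leb_itv a b) (fun t => if a <= t <= b then phi t * u t else 0).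

Let ReC_continuous : continuous (@complex.Re R : R[i]^o -> R).
Proof.
move=> z; have FF : Filter (nbhs (z : R[i]^o)) by exact: nbhs_filter.
apply/(@cvgrPdist_lt R R R[i]^o (nbhs (z : R[i]^o)) FF) => e e0.
have e0' : 0 < e%:C :> R[i] by rewrite ltcR.
have /cvgrPdist_lt/(_ _ e0') : id w @[w --> (z : R[i]^o)] --> (z : R[i]^o).
  exact: cvg_id.
apply: filterS => w; rewrite -ltcR; apply: le_lt_trans; rewrite -raddfB.
exact: normc_ge_Re.
Qed.

Let normc_ge_Im (z : R[i]) : `|complex.Im z|%:C <= `|z|.
Proof.
have := normc_ge_Re ('i * z)%C; rewrite normrM (_ : `|'i%C| = 1 :> R[i]).
  rewrite mul1r; apply: le_trans; rewrite lecR.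
  by case: z => x y /=; rewrite mul0r mul1r sub0r normrN.
by rewrite normc_def/= expr0n/= expr1n add0r sqrtr1.
Qed.

Let ImC_continuous : continuous (@complex.Im R : R[i]^o -> R).
Proof.
move=> z; have FF : Filter (nbhs (z : R[i]^o)) by exact: nbhs_filter.
apply/(@cvgrPdist_lt R R R[i]^o (nbhs (z : R[i]^o)) FF) => e e0.
have e0' : 0 < e%:C :> R[i] by rewrite ltcR.
have /cvgrPdist_lt/(_ _ e0') : id w @[w --> (z : R[i]^o)] --> (z : R[i]^o).
  exact: cvg_id.
apply: filterS => w; rewrite -ltcR; apply: le_lt_trans; rewrite -raddfB.
exact: normc_ge_Im.
Qed.

Let restr_itv a b (f : R -> R) : {within `[a, b], continuous f} ->
  let g := fun t => if a <= t <= b then f t else 0 in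
  measurable_fun (setT : set (measurableTypeR R)) g /\
  exists M : R, forall t, `|g t| <= M.
Proof.
move=> cf g; have gE : g = f \_ `[a, b].
  by apply/funext => t; rewrite /g patchE mem_setE in_itv.
split.
  rewrite gE; apply/(measurable_restrictT _ (measurable_itv `[a, b])).
  exact: (subspace_continuous_measurable_fun (measurable_itv `[a, b])).
have [M [_ Mf]] := compact_bounded (continuous_compact cf (@segment_compact _ a b)).
exists (Num.max 0 (M + 1)) => t; rewrite /g; case: ifPn => [tab|_].
  rewrite le_max; apply/orP; right; apply: Mf; first by rewrite ltrDl.
  by exists t => //=; rewrite in_itv.
by rewrite normr0 le_max lexx.
Qed.

Let ae_itv a b : {ae leb_itv a b, forall t, a <= t <= b}.
Proof.
exists (~` `[a, b]); split.
- exact: measurableC.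
- by rewrite /leb_itv/= /mrestr setICl measure0.
- by move=> t /=; rewrite in_itv.
Qed.

Lemma mulopE a b phi (u : L2itv a b) : continuous_on a b phi ->
  {ae leb_itv a b, forall t, mulop phi u t = phi t * u t}.
Proof.
move=> cphi; set g := fun t => if a <= t <= b then phi t * u t else 0.
have cre : {within `[a, b], continuous (@complex.Re R \o phi)}.
  by apply: within_continuous_comp cphi => ? _; exact: ReC_continuous.
have cim : {within `[a, b], continuous (@complex.Im R \o phi)}.
  by apply: within_continuous_comp cphi => ? _; exact: ImC_continuous.
have [mr [Mr br]] := restr_itv cre.
have [mi [Mi bi]] := restr_itv cim.
have ig : sqintegrable (leb_itv a b) g.
  have := sqintegrableM_bounded mr br mi bi (L2_sqintegrable u).
  congr sqintegrable; apply/funext => t; rewrite /g /=.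
  by case: ifP => _; [case: (phi t)|rewrite mul0r].
apply: filterS2 (toL2K ig) (ae_itv a b) => t -> tab.
by rewrite /g tab.
Qed.

Definition Hspace (d : R) : lmodType R[i] :=
  (R[i]^o * R[i]^o * L2itv 1 d * L2itv 1 d)%type.

Definition Hdot (d : R) (x y : Hspace d) : R[i] :=
  x.1.1.1 * (y.1.1.1)^*%R + x.1.1.2 * (y.1.1.2)^*%R +
  L2dot x.1.2 y.1.2 + L2dot x.2 y.2.

Let Hdot_linear d v a (u w : Hspace d) :
  Hdot (a *: u + w) v = a * Hdot u v + Hdot w v.
Proof.
have aux (c p q p' q' r r' s s' m n : R[i]) :
    (c * p + q) * m + (c * p' + q') * n + (c * r + r') + (c * s + s') =
    c * (p * m + p' * n + r + s) + (q * m + q' * n + r' + s') by ring.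
by rewrite /Hdot/= !L2dot_linear; exact: aux.
Qed.

Let Hdot_hermitian d (u v : Hspace d) : Hdot u v = (Hdot v u)^*%R.
Proof.
by rewrite /Hdot [L2dot u.1.2 _]L2dot_hermitian [L2dot u.2 _]L2dot_hermitian
  !rmorphD !rmorphM/= !conjCK ![_^*%R * _]mulrC.
Qed.

Let Hdot_gt0 d (u : Hspace d) : u != 0 -> 0 < Hdot u u.
Proof.
have L2_ge0 (v : L2itv 1 d) : 0 <= L2dot v v.
  by have [->|/L2dot_gt0/ltW//] := eqVneq v 0; rewrite linear0r.
have L2_eq0 (v : L2itv 1 d) : L2dot v v = 0 -> v = 0.
  by move=> v0; apply/eqP; apply: contraT => /L2dot_gt0; rewrite v0 ltxx.
case: u => [[[x y] f] g]; rewrite /Hdot/=.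
have hx := mul_conjC_ge0 x; have hy := mul_conjC_ge0 y.
move=> u0; rewrite lt_neqAle !addr_ge0// andbT eq_sym.
apply: contra_neqN u0; rewrite !paddr_eq0 ?addr_ge0// !mul_conjC_eq0.
by move=> /andP[/andP[/andP[/eqP-> /eqP->] /eqP/L2_eq0->] /eqP/L2_eq0->].
Qed.

Let Hdot_bilinear d : bilinear_for (GRing.Scale.Law.clone _ _ *%R _)
  (GRing.Scale.Law.clone _ _ (@Num.conj R[i] \; *%R) _) (@Hdot d).
Proof.
split=> [v a u w|u a v w] /=; first exact: Hdot_linear.
rewrite Hdot_hermitian Hdot_linear rmorphD rmorphM/=.
by rewrite -!Hdot_hermitian.
Qed.
HB.instance Definition _ d := bilinear_isBilinear.Build R[i] (Hspace d) (Hspace d) R[i]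
  _ _ (@Hdot d) (@Hdot_bilinear d).
Let Hdot_herm d (u v : Hspace d) : Hdot u v = (-1) ^+ false * Num.conj (Hdot v u).
Proof. by rewrite expr0 mul1r -Hdot_hermitian. Qed.
HB.instance Definition _ d := isHermitianSesquilinear.Build R[i] (Hspace d) false
  Num.conj (@Hdot d) (@Hdot_herm d).
HB.instance Definition _ d :=
  isDotProduct.Build R[i] (Hspace d) (@Hdot d) (@Hdot_gt0 d).

(* The action of z + 0 + [[A, B], [C, D]] in C + 0 + M_2(C[1, d]). *)
Definition dsum_op (d : R) (z : R[i]) (A B C D : R -> R[i]) (x : Hspace d) :
    Hspace d :=
  (z * x.1.1.1, 0, mulop A x.1.2 + mulop B x.2, mulop C x.1.2 + mulop D x.2).

Definition I0 (t : R) : R[i] := 1.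
Definition D0 (t : R) : R[i] := t%:C.
Definition ellD0 (t : R) : R[i] := (Num.sqrt (t * (t - 1)))%:C.

Let real_complex_continuous : continuous ((fun t => t%:C) : R -> R[i]^o).
Proof.
move=> x; apply/(@cvgrPdist_lt _ R[i]^o) => e e0.
have eE : e = (complex.Re e)%:C.
  by move: e0; rewrite ltcE => /andP[/eqP]; case: e => u v /= ->.
have e0' : 0 < complex.Re e by rewrite -ltcR -eE.
have /cvgrPdist_lt/(_ _ e0') : id w @[w --> x] --> x by exact: cvg_id.
apply: filterS => w xw; rewrite eE -rmorphB normc_def /= expr0n addr0 sqrtr_sqr.
by rewrite ltcR.
Qed.

Let continuous_on_real a b (f : R -> R) : continuous f ->
  continuous_on a b (fun t => (f t)%:C).
Proof.
move=> cf; apply: continuous_subspaceT => t.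
exact: (continuous_comp (cf t) (@real_complex_continuous (f t))).
Qed.

Fact I0_continuous a b : continuous_on a b I0.
Proof. by apply: (@continuous_on_real _ _ (cst 1)) => t; exact: cvg_cst. Qed.
Fact D0_continuous a b : continuous_on a b D0.
Proof. by apply: continuous_on_real => t; exact: cvg_id. Qed.
Let ell_continuous : continuous (fun t : R => Num.sqrt (t * (t - 1))).
Proof.
move=> t; apply: (@continuous_comp _ _ _ (fun t : R => t * (t - 1)) Num.sqrt).
  by apply: cvgM; [exact: cvg_id|apply: cvgB; [exact: cvg_id|exact: cvg_cst]].
exact: sqrt_continuous.
Qed.
Fact ellD0_continuous a b : continuous_on a b ellD0.
Proof. exact: continuous_on_real. Qed.

Definition Qop (d : R) : Hspace d -> Hspace d :=
  dsum_op 1 D0 (- ellD0) ellD0 (I0 - D0).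

Lemma Qop_idempotent d : @Qop d \o @Qop d = @Qop d.
Proof.
have cN : continuous_on 1 d (- ellD0).
  rewrite (_ : - ellD0 = fun t => (- Num.sqrt (t * (t - 1)))%:C).
    by apply: continuous_on_real => t; apply: cvgN; exact: ell_continuous.
  by apply/funext => t; rewrite rmorphN.
have cB : continuous_on 1 d (I0 - D0).
  rewrite (_ : I0 - D0 = fun t => (1 - t)%:C).
    by apply: continuous_on_real => t; apply: cvgB; [exact: cvg_cst|exact: cvg_id].
  by apply/funext => t; rewrite rmorphB.
have comb A B (f g : L2itv 1 d) : continuous_on 1 d A -> continuous_on 1 d B ->
    {ae leb_itv 1 d, forall t,
      (mulop A f + mulop B g : L2itv 1 d) t = A t * f t + B t * g t}.
  move=> cA cB'; apply: filterS3 (L2_DE (mulop A f) (mulop B g)) (mulopE f cA)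
    (mulopE g cB') => t.
  by move=> -> -> ->.
have ell2 t : 1 <= t -> ellD0 t * ellD0 t = D0 t * D0 t - D0 t.
  move=> t1; rewrite /ellD0 /D0 -!rmorphM -rmorphB -expr2 sqr_sqrtr ?mulrBr ?mulr1//.
  by rewrite -{3}[t]mulr1 -mulrBr mulr_ge0 ?subr_ge0// (le_trans ler01).
apply/funext => -[[[x y] f] g]; rewrite /Qop /dsum_op /= !mul1r.
have cD := @D0_continuous 1 d; have cl := @ellD0_continuous 1 d.
have h1 := comb D0 (- ellD0) f g cD cN; have h2 := comb _ _ f g cl cB.
set F := mulop D0 f + _ in h1 *; set G := mulop ellD0 f + _ in h2 *.
have h3 := comb D0 (- ellD0) F G cD cN; have h4 := comb _ _ F G cl cB.
congr (_, _, _, _); apply/L2P.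
  apply: filterS3 (filterI h3 (ae_itv 1 d)) h1 h2 => t [-> /andP[t1 _]] -> ->.
  rewrite -[(- ellD0) t]/(- ellD0 t) -[(I0 - D0) t]/(1 - D0 t); move: (ell2 t t1).
  move: (ellD0 t) (D0 t) ((f : L2itv 1 d) t) ((g : L2itv 1 d) t) => l D p q lE.
  rewrite [LHS](_ : _ = (D * D - l * l) * p - l * q); last by ring.
  by rewrite lE; ring.
apply: filterS3 (filterI h4 (ae_itv 1 d)) h1 h2 => t [-> /andP[t1 _]] -> ->.
rewrite -[(- ellD0) t]/(- ellD0 t) -[(I0 - D0) t]/(1 - D0 t); move: (ell2 t t1).
move: (ellD0 t) (D0 t) ((f : L2itv 1 d) t) ((g : L2itv 1 d) t) => l D p q lE.
rewrite [LHS](_ : _ = l * p + (1 - D) * q + (D * D - D - l * l) * q); last by ring.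
by rewrite lE; ring.
Qed.

End Interval.

Arguments Hdot {R d} x y.
Arguments Qop {R} d x.

(* Main.v *)
(* Fiberwise, [Q] is the rank one idempotent [[t, -l], [l, 1 - t]] with
   [l^2 = t (t - 1)], and [|Q^*| = A := [[t, l], [l, t - 1]]] with
   [A^2 = (2 t - 1) A].  The factors of m(Q) are then rational in [A], and
   m(Q) = 1 + 0 + [[1, 0], [0, 0]], hence T = 2 + 0 + [[1 + t, -l], [0, 0]].

   The fiber at [t] has as numerical range the ellipse with foci 0, 1 + t and
   minor semi-axis l(t) / 2; these ellipses increase with [t], and the one at
   [t = d] has 0 and 2 in its interior.  Since [t = d] is a null set, no value of
   <T x, x> reaches a supporting line of the last ellipse, while vectors
   concentrated near [t = d] realize all its interior points. *)
Require Import Defs.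
From mathcomp Require Import all_boot all_order all_algebra.
From mathcomp Require Import all_classical all_reals all_analysis.
From mathcomp Require Import complex.
From mathcomp Require Import measurable_realfun sesquilinear ring lra.
Import Order.TTheory GRing.Theory Num.Theory.
Import numFieldNormedType.Exports.
Local Open Scope classical_set_scope.
Local Open Scope ring_scope.
Local Open Scope complex_scope.

Set Implicit Arguments.
Unset Strict Implicit.
Unset Printing Implicit Defensive.

(** * Uniqueness of the operators selected by [xget] *)

Section DefiniteDescriptions.
Context {C : numClosedFieldType} {H : lmodType C} (ip : {dot H for @Num.conj C}).
Implicit Types (S T X : H -> H).

(** Each factor of m(Q) is a choice made by [xget], so it becomes known only through a uniqueness
    proof. For adjoints, inverses and Moore-Penrose inverses this is algebra. The positive square
    root is the obstacle. It is settled by norm estimates, which work because the nonzero fiber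
    eigenvalue of [A] is [2 t - 1 >= 1], so that [A] is bounded below on its range. All other
    identities between operators become rational identities in [t] and [l], modulo
    [l^2 = t (t - 1)].

    The constants of the ellipse come from the fiber at [d]: as 0 is a focus, the center
    [c = (1 + d) / 2] is also the half focal distance. With [b^2 = d (d - 1) / 4] this gives
    [a^2 = c^2 + b^2 = (2 d^2 + d + 1) / 4], a relation on which the algebra of both inclusions
    rests. Each interior point is attained by one explicit vector, whose norm is completed to 1 in
    the summand killed by [T]. *)

Lemma dotC x y : ip x y = (ip y x)^*%R.
Proof. by rewrite hermC expr0 mul1r. Qed.

Lemma dot_injr x y : (forall z, ip z x = ip z y) -> x = y.
Proof.
move=> xy; apply/eqP; rewrite -subr_eq0 -(dnorm_eq0 ip).
by rewrite linearBr /= xy subrr.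
Qed.

Lemma adjointE T S : bounded_op ip S -> is_adjoint ip T S -> adjoint ip T = S.
Proof.
move=> bS TS; apply: xget_subset1 => // U V [_ TU] [_ TV].
by apply/funext => y; apply: dot_injr => x; rewrite -TU -TV.
Qed.

(** [T X] and [T Y] are self-adjoint and both fix the range of [T], which forces them to agree; so
    do [X T] and [Y T] by the symmetric argument. Then [X = X T X = X T Y = Y T Y = Y]. *)
Lemma is_mp_inverse_unique T X Y :
  is_mp_inverse ip T X -> is_mp_inverse ip T Y -> X = Y.
Proof.
move=> [TXT XTX hTX hXT] [TYT YTY hTY hYT].
have sTX x y : ip (T (X x)) y = ip x (T (X y)) by exact: hTX.
have sTY x y : ip (T (Y x)) y = ip x (T (Y y)) by exact: hTY.
have sXT x y : ip (X (T x)) y = ip x (X (T y)) by exact: hXT.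
have sYT x y : ip (Y (T x)) y = ip x (Y (T y)) by exact: hYT.
have eTXT x : T (X (T x)) = T x by rewrite -[in RHS]TXT.
have eTYT x : T (Y (T x)) = T x by rewrite -[in RHS]TYT.
have eXTX x : X (T (X x)) = X x by rewrite -[in RHS]XTX.
have eYTY x : Y (T (Y x)) = Y x by rewrite -[in RHS]YTY.
have TXY y : T (X y) = T (Y y).
  by apply: dot_injr => z; rewrite -sTX -[T (X z)]eTYT sTY sTX eTXT.
have XYT y : X (T y) = Y (T y).
  by apply: dot_injr => z; rewrite -sXT -[T z]eTYT sXT sYT eTXT.
by apply/funext => y; rewrite -eXTX TXY XYT eYTY.
Qed.

Lemma mp_inverseE T X :
  bounded_op ip X -> is_mp_inverse ip T X -> mp_inverse ip T = X.
Proof.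
move=> bX TX; apply: xget_subset1 => // U V [_ TU] [_ TV].
exact: is_mp_inverse_unique TU TV.
Qed.

Lemma op_invE T X :
  bounded_op ip X -> T \o X = id -> X \o T = id -> op_inv ip T = X.
Proof.
move=> bX TX XT; apply: xget_subset1 => // U V [_ _ UT] [_ TV _].
apply/funext => y; transitivity (U (T (V y))).
  by rewrite -[T (V y)]/((T \o V) y) TV.
by rewrite -[LHS]/((U \o T) (V y)) UT.
Qed.

End DefiniteDescriptions.

(** * Uniqueness of the positive square root, by norm estimates *)

Section SquareRoot.
Context {R : realType} {H : lmodType R[i]} (ip : {dot H for @Num.conj R[i]}).
Implicit Types (x y : H) (S A P : H -> H).

(** Real parts bring the estimates into [R], where the order is total and [lra] and [nra] apply. *)
Definition rdot x y : R := complex.Re (ip x y).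
Definition sqnorm x : R := rdot x x.

Lemma rdotC x y : rdot x y = rdot y x.
Proof. by rewrite /rdot dotC; case: (ip y x). Qed.

Lemma rdotDl x y z : rdot (x + y) z = rdot x z + rdot y z.
Proof. by rewrite /rdot linearDl raddfD. Qed.

Lemma rdotBl x y z : rdot (x - y) z = rdot x z - rdot y z.
Proof. by rewrite /rdot linearBl raddfB. Qed.

Lemma rdotZl (c : R) x y : rdot (c%:C *: x) y = c * rdot x y.
Proof.
by rewrite /rdot linearZl_LR /=; case: (ip x y) => u v /=; rewrite mul0r subr0.
Qed.

Lemma rdotDr x y z : rdot z (x + y) = rdot z x + rdot z y.
Proof. by rewrite rdotC rdotDl !(rdotC z). Qed.

Lemma rdotBr x y z : rdot z (x - y) = rdot z x - rdot z y.
Proof. by rewrite rdotC rdotBl !(rdotC z). Qed.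

Lemma rdotZr (c : R) x y : rdot x (c%:C *: y) = c * rdot x y.
Proof. by rewrite rdotC rdotZl rdotC. Qed.

Lemma sqnormE x : ip x x = (sqnorm x)%:C.
Proof. by rewrite /sqnorm /rdot RRe_real// ger0_real// dnorm_ge0. Qed.

Lemma sqnorm_ge0 x : 0 <= sqnorm x.
Proof. by rewrite -ler0c -sqnormE dnorm_ge0. Qed.

Lemma sqnorm_eq0 x : sqnorm x = 0 -> x = 0.
Proof. by move=> x0; apply/eqP; rewrite -(dnorm_eq0 ip) sqnormE x0. Qed.

Lemma sqnormD x y : sqnorm (x + y) = sqnorm x + 2 * rdot x y + sqnorm y.
Proof. by rewrite /sqnorm rdotDl !rdotDr (rdotC y x); ring. Qed.

Lemma sqnormB x y : sqnorm (x - y) = sqnorm x - 2 * rdot x y + sqnorm y.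
Proof. by rewrite /sqnorm rdotBl !rdotBr (rdotC y x); ring. Qed.

Lemma sqnormN x : sqnorm (- x) = sqnorm x.
Proof. by rewrite /sqnorm /rdot hnormN. Qed.

Lemma sqnormZ (c : R) x : sqnorm (c%:C *: x) = c ^+ 2 * sqnorm x.
Proof. by rewrite /sqnorm rdotZl rdotZr expr2 mulrA. Qed.

Lemma sqnormD_le x y : sqnorm (x + y) <= 2 * sqnorm x + 2 * sqnorm y.
Proof. by have := sqnorm_ge0 (x - y); rewrite sqnormB sqnormD => ?; lra. Qed.

(** The bound in [bounded_op] is a complex number; its modulus serves as a real bound, and adding 1
    makes it positive. *)
Lemma bounded_op_sqnorm S : bounded_op ip S ->
  exists2 M : R, 0 < M & forall x, sqnorm (S x) <= M ^+ 2 * sqnorm x.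
Proof.
move=> [_ [M SM]]; pose N := (complex.Re `|M|).
have NM : N%:C = `|M| by rewrite /N normc_def.
have N0 : 0 <= N by rewrite -ler0c NM.
exists (N + 1) => [|x]; first by rewrite ltr_wpDl.
apply: (@le_trans _ _ (N ^+ 2 * sqnorm x)); last first.
  rewrite ler_wpM2r ?sqnorm_ge0// lerXn2r ?nnegrE ?addr_ge0// lerDl//.
rewrite -lecR rmorphM rmorphXn /= -!sqnormE NM.
have h0 : 0 <= hnorm ip (S x) by rewrite sqrtC_ge0 dnorm_ge0.
have : hnorm ip (S x) <= `|M| * hnorm ip x.
  have := normr_ge0 (M * hnorm ip x).
  move: (SM x) => /(le_trans h0) Mx.
  have hx : `|hnorm ip x| = hnorm ip x by rewrite ger0_norm ?sqrtC_ge0 ?dnorm_ge0.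
  by rewrite -hx -normrM ger0_norm.
move=> /(lerXn2r 2); rewrite !nnegrE h0 mulr_ge0 ?sqrtC_ge0 ?dnorm_ge0//.
by move=> /(_ isT isT); rewrite exprMn /hnorm !sqrtCK.
Qed.

Lemma sqnorm_bounded_op S (M : R) : linear S -> 0 <= M ->
  (forall x, sqnorm (S x) <= M ^+ 2 * sqnorm x) -> bounded_op ip S.
Proof.
move=> lS M0 SM; split=> //; exists M%:C => x.
rewrite -ler_sqr ?nnegrE ?mulr_ge0 ?sqrtC_ge0 ?dnorm_ge0 ?ler0c//.
by rewrite exprMn /hnorm !sqrtCK !sqnormE -rmorphXn -rmorphM lecR.
Qed.

(** Polarization: as [<S z, z>] is real for [z = u + v], the imaginary parts of [<S u, v>] and
    [<S v, u>] are opposite. Replacing [x] by [i x] compares the real parts. *)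
Lemma positive_op_selfadjoint S : positive_op ip S -> is_adjoint ip S S.
Proof.
move=> [[lS _] pS] x y.
have SD u v : S (u + v) = S u + S v by have := lS 1 u v; rewrite !scale1r.
have ImS u v : complex.Im (ip (S u) v) = - complex.Im (ip (S v) u).
  have := ger0_Im (pS (u + v)); rewrite SD linearDl !linearDr /= !raddfD /=.
  by rewrite (ger0_Im (pS u)) (ger0_Im (pS v)) => ?; lra.
have := ImS ('i%C *: x) y; rewrite (scalable_linear lS) linearZl_LR linearZr_LR /= => ReS.
rewrite [RHS]dotC; move: ReS (ImS x y).
case: (ip (S x) y) => a b; case: (ip (S y) x) => e f /=.
by rewrite /= => ? ?; congr (_ +i* _); lra.
Qed.

(* [0 <= S <= M] makes [S - c] a contraction up to the factor [c], for [c >= M]: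
   the crux is [S^2 <= M S]. *)
Lemma positive_op_shift S (M c : R) x : positive_op ip S -> 0 < M -> M <= c ->
  (forall y, sqnorm (S y) <= M ^+ 2 * sqnorm y) ->
  sqnorm (S x - c%:C *: x) <= c ^+ 2 * sqnorm x.
Proof.
move=> pS M0 Mc SM; have [[lS _] p] := pS.
have sS := positive_op_selfadjoint pS.
have q0 y : 0 <= rdot (S y) y by have := p y; rewrite lecE => /andP[].
have rS y z : rdot (S y) z = rdot y (S z) by rewrite /rdot sS.
have SP a y z : S (y - a *: z) = S y - a *: S z.
  by rewrite (zmod_morphism_linear lS) (scalable_linear lS).
have expand (a : R) y : sqnorm (S y - a%:C *: y) =
    sqnorm (S y) - 2 * a * rdot (S y) y + a ^+ 2 * sqnorm y.
  by rewrite sqnormB rdotZr sqnormZ; ring.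
have qM y : rdot (S y) y <= M * sqnorm y.
  have := sqnorm_ge0 (S y - M%:C *: y); rewrite expand => h.
  by rewrite -(ler_pM2l M0); have := SM y; nra.
(* Positivity of [S] at [S x - M x] reads [<S^3 x, x> - 2 M |S x|^2 + M^2 <S x, x> >= 0], and [qM]
   at [S x] bounds the first term by [M |S x|^2]. *)
have SS : sqnorm (S x) <= M * rdot (S x) x.
  have := q0 (S x - M%:C *: x); have := qM (S x).
  rewrite SP rdotBl !rdotBr !rdotZl !rdotZr -[rdot (S (S x)) x]/_ (rS (S x) x).
  rewrite -/(sqnorm (S x)) => h1 h2.
  by rewrite -(ler_pM2l M0); nra.
by rewrite expand; have := q0 x; nra.
Qed.

(* With [D := S - A] and [D = D P], [S^2 = A^2] reads [S D = - D A], that is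
   [2 c D = - (S - c) D - D (A - c P)].  For [c] large the right-hand side has
   norm less than [2 c |D|] unless [D = 0], because [A] is bounded below on the
   range of [P]. *)
Lemma positive_op_sqrt_unique S A P (c0 : R) : positive_op ip S ->
  bounded_op ip A -> linear P -> A \o P = A -> S \o S = A \o A ->
  (forall c x, c0 <= c -> sqnorm (A x - c%:C *: P x) <= (c - 1) ^+ 2 * sqnorm x) ->
  S = A.
Proof.
move=> pS bA lP AP SA Abelow; have [bS _] := pS; have [lS _] := bS; have [lA _] := bA.
have sS := positive_op_selfadjoint pS.
have [M M0 SM] := bounded_op_sqnorm bS; have [N N0 AN] := bounded_op_sqnorm bA.
have eSA x : S (S x) = A (A x) by rewrite -[S (S x)]/((S \o S) x) SA.
have eAP x : A (P x) = A x by rewrite -[A (P x)]/((A \o P) x) AP.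
have SB := zmod_morphism_linear lS; have AB := zmod_morphism_linear lA.
have A0 : A 0 = 0 by rewrite -{1}[0](subrr 0) AB subrr.
have SZ a x : S (a *: x) = a *: S x by rewrite (scalable_linear lS).
have AZ a x : A (a *: x) = a *: A x by rewrite (scalable_linear lA).
(* [S] and [A] have the same kernel: [|S z|^2 = <z, S^2 z> = <z, A^2 z>], which vanishes for
   [z = P x - x]. *)
have eSP x : S (P x) = S x.
  apply/eqP; rewrite -subr_eq0 -SB; apply/eqP/sqnorm_eq0.
  by rewrite /sqnorm /rdot sS eSA AB eAP subrr A0 linear0r.
pose D x := S x - A x; pose c := c0 + M + 1 + `|c0|.
have c1 : 1 < c by have := ler_norm (- c0); rewrite normrN /c; lra.
have Mc : M <= c by have := ler_norm (- c0); rewrite normrN /c; lra.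
have cc : c0 <= c by have := normr_ge0 c0; rewrite /c; lra.
have eD x : (2 * c)%:C *: D x =
    - (S (D x) - c%:C *: D x) - D (A x - c%:C *: P x).
  have eDP : D (P x) = D x by rewrite /D eSP eAP.
  have lD y z a : D (y - a *: z) = D y - a *: D z.
    by rewrite /D SB AB SZ AZ scalerBr [in LHS]opprD addrACA -opprD.
  rewrite lD eDP [S (D x)]SB eSA [D (A x)]/D rmorphM rmorph_nat /= -scalerA.
  move: (A (A x)) (S (A x)) (c%:C *: D x) => u v w.
  by rewrite scaler_nat mulr2n !opprB addrACA -[u - v]opprB subrr addr0.
(* If [|D x|^2 <= K |x|^2] for all [x], the two terms on the right of [eD] have squared norms at
   most [c^2 |D x|^2] and [K (c - 1)^2 |x|^2]. By [|u + v|^2 <= 2 |u|^2 + 2 |v|^2] the first absorbs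
   half of [4 c^2 |D x|^2], and the bound [K] improves to [k K]. Since [k < 1], iteration gives
   [D = 0]. *)
pose k := ((c - 1) / c) ^+ 2.
have kD K : 0 <= K -> (forall x, sqnorm (D x) <= K * sqnorm x) ->
    forall x, sqnorm (D x) <= k * K * sqnorm x.
  move=> K0 DK x; have := sqnormZ (2 * c) (D x); rewrite eD => e.
  have := sqnormD_le (- (S (D x) - c%:C *: D x)) (- D (A x - c%:C *: P x)).
  rewrite e !sqnormN => h.
  have h1 := positive_op_shift (D x) pS M0 Mc SM.
  have h2 := le_trans (DK _) (ler_wpM2l K0 (Abelow c x cc)).
  have kE : k * K * sqnorm x = (K * ((c - 1) ^+ 2 * sqnorm x)) / c ^+ 2.
    by rewrite /k expr_div_n; ring.
  by rewrite kE ler_pdivlMr ?exprn_gt0//; [nra|lra].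
pose K0 := 2 * M ^+ 2 + 2 * N ^+ 2.
have K0_ge0 : 0 <= K0 by rewrite addr_ge0// mulr_ge0// sqr_ge0.
have kn n x : sqnorm (D x) <= K0 * k ^+ n * sqnorm x.
  elim: n x => [|n IHn] x; last first.
    rewrite exprS mulrCA; apply: kD => //.
    by apply: mulr_ge0 => //; apply: exprn_ge0; exact: sqr_ge0.
  rewrite expr0 mulr1; have := sqnormD_le (S x) (- A x); rewrite sqnormN -/(D x).
  by have := SM x; have := AN x; rewrite /K0 mulrDl -!mulrA; lra.
apply/funext => x; apply/eqP; rewrite -subr_eq0 -/(D x); apply/eqP/sqnorm_eq0.
apply/le_anti; rewrite sqnorm_ge0 andbT.
have k_lt1 : `|k| < 1.
  rewrite ger0_norm ?sqr_ge0// expr_lt1 ?divr_ge0//; [|lra|lra].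
  by rewrite ltr_pdivrMr; lra.
apply: (cvgr_to_ge (cvg_geometric (K0 * sqnorm x) k_lt1)).
by apply: nearW => n; rewrite /= mulrAC.
Qed.

Lemma op_sqrtE T A P (c0 : R) : positive_op ip A -> A \o A = T -> linear P ->
  A \o P = A ->
  (forall c x, c0 <= c -> sqnorm (A x - c%:C *: P x) <= (c - 1) ^+ 2 * sqnorm x) ->
  op_sqrt ip T = A.
Proof.
move=> pA AT lP AP Abelow; apply: xget_unique => // S [pS ST].
exact: (positive_op_sqrt_unique pS (proj1 pA) lP AP (etrans ST (esym AT)) Abelow).
Qed.

End SquareRoot.

(** * Operators acting fiberwise by a real matrix *)

Section AeIntegral.
Context d (T : measurableType d) (R : realType) (mu : {measure set T -> \bar R}).

Lemma Rintegral_ae_ge0 (f : T -> R) : mu.-integrable setT (EFin \o f) ->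
  {ae mu, forall t, 0 <= f t} -> 0 <= \int[mu]_t f t.
Proof.
move=> /measurable_int mf f0.
rewrite (_ : \int[mu]_t f t = \int[mu]_t `|f t|); first exact: Rintegral_ge0.
congr fine; apply: ae_eq_integral => //.
  by apply/measurable_EFinP; apply: measurableT_comp => //; exact/measurable_EFinP.
by apply: filterS f0 => t /= f0 _; rewrite ger0_norm.
Qed.

Lemma Rintegral_ae_le (f g : T -> R) : mu.-integrable setT (EFin \o f) ->
  mu.-integrable setT (EFin \o g) -> {ae mu, forall t, f t <= g t} ->
  \int[mu]_t f t <= \int[mu]_t g t.
Proof.
move=> fi gi fg; rewrite -subr_ge0 -RintegralB//; apply: Rintegral_ae_ge0.
  by have := integrableB measurableT gi fi.
by apply: filterS fg => t; rewrite subr_ge0.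
Qed.

Lemma Rintegral_ae_eq0 (f : T -> R) : mu.-integrable setT (EFin \o f) ->
  {ae mu, forall t, 0 <= f t} -> \int[mu]_t f t = 0 -> {ae mu, forall t, f t = 0}.
Proof.
move=> fi f0 /eqP; rewrite /Rintegral fine_eq0 ?integrable_fin_num// => /eqP if0.
have mf := measurable_int _ fi.
have : ae_eq mu setT (EFin \o f) (cst 0%E).
  apply/ae_eq_integral_abs => //; rewrite -[RHS]if0.
  apply: ae_eq_integral => //; first exact: measurableT_comp.
  by apply: filterS f0 => t /= f0 _; rewrite ger0_norm.
by apply: filterS => t /(_ I) /= [].
Qed.

End AeIntegral.

Section FiberwiseOperators.
Context {R : realType} (d : R).
Local Notation leb := (leb_itv 1 d).
Implicit Types (x y : Hspace d) (G : Hspace d -> Hspace d).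

(** The endpoint [d] is discarded because the fiber form of a supporting line is definite only for
    [t < d]; the strict inequality of the final ellipse originates here. *)
Lemma ae_itvco : {ae leb, forall t, 1 <= t < d}.
Proof.
exists (~` `[1, d[%classic); split.
- exact: measurableC.
- rewrite /leb_itv/= /mrestr.
  apply: (@subset_measure0 _ _ _ (@lebesgue_measure R) _ [set d]) => //.
  + by apply: measurableI => //; exact: measurableC.
  + move=> t /= []; rewrite !in_itv /= => /negP + /andP[t1 td].
    by rewrite t1 /= -leNgt => dt; apply/le_anti; rewrite td.
  + exact: lebesgue_measure_set1.
- by move=> t /=; rewrite in_itv.
Qed.

Definition sca1 x : R[i] := x.1.1.1.
Definition sca2 x : R[i] := x.1.1.2.
Definition fib1 x : L2 leb := x.1.2.
Definition fib2 x : L2 leb := x.2.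

Lemma fibD x y : {ae leb, forall t,
  fib1 (x + y) t = fib1 x t + fib1 y t /\ fib2 (x + y) t = fib2 x t + fib2 y t}.
Proof. exact: filterS2 (L2_DE (fib1 x) (fib1 y)) (L2_DE (fib2 x) (fib2 y)). Qed.

Lemma fibZ a x : {ae leb, forall t,
  fib1 (a *: x) t = a * fib1 x t /\ fib2 (a *: x) t = a * fib2 x t}.
Proof. exact: filterS2 (L2_ZE a (fib1 x)) (L2_ZE a (fib2 x)). Qed.

Lemma sca1D x y : sca1 (x + y) = sca1 x + sca1 y. Proof. by []. Qed.
Lemma sca2D x y : sca2 (x + y) = sca2 x + sca2 y. Proof. by []. Qed.
Lemma sca1Z a x : sca1 (a *: x) = a * sca1 x. Proof. by rewrite /sca1 /=. Qed.
Lemma sca2Z a x : sca2 (a *: x) = a * sca2 x. Proof. by rewrite /sca2 /=. Qed.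

Lemma fibP a x y : {ae leb, forall t,
  fib1 (a *: x + y) t = a * fib1 x t + fib1 y t /\
  fib2 (a *: x + y) t = a * fib2 x t + fib2 y t}.
Proof. by apply: filterS2 (fibD (a *: x) y) (fibZ a x) => t [-> ->] [-> ->]. Qed.

Definition fiber_dot x y (t : R) : R[i] :=
  (fib1 x) t * ((fib1 y) t)^*%R + (fib2 x) t * ((fib2 y) t)^*%R.

Lemma Cintegrable_fiber_dot x y : Cintegrable leb (fiber_dot x y).
Proof.
have i1 := sqintegrable_mul (L2_sqintegrable (fib1 x)) (L2_sqintegrable (fib1 y)).
have i2 := sqintegrable_mul (L2_sqintegrable (fib2 x)) (L2_sqintegrable (fib2 y)).
have [+ _] := CintegralP 1 i1 i2.
by under [X in Cintegrable _ X]eq_fun do rewrite mul1r.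
Qed.

Lemma Hdot_fiber x y : Hdot x y =
  sca1 x * (sca1 y)^*%R + sca2 x * (sca2 y)^*%R + Cintegral leb (fiber_dot x y).
Proof.
have i1 := sqintegrable_mul (L2_sqintegrable (fib1 x)) (L2_sqintegrable (fib1 y)).
have i2 := sqintegrable_mul (L2_sqintegrable (fib2 x)) (L2_sqintegrable (fib2 y)).
have [_] := CintegralP 1 i1 i2.
under [X in Cintegral _ X]eq_fun do rewrite mul1r.
by rewrite /Hdot -addrA mul1r => <-.
Qed.

Definition fiber_rdot x y (t : R) : R := complex.Re (fiber_dot x y t).

Definition scalar_rdot x y : R :=
  complex.Re (sca1 x * (sca1 y)^*%R) + complex.Re (sca2 x * (sca2 y)^*%R).

Lemma integrable_fiber_rdot x y : leb.-integrable setT (EFin \o fiber_rdot x y).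
Proof. by have [] := Cintegrable_fiber_dot x y. Qed.

Lemma rdot_fiber x y :
  rdot Hdot x y = scalar_rdot x y + \int[leb]_t fiber_rdot x y t.
Proof.
by rewrite -[rdot _ x y]/(complex.Re (Hdot x y)) /scalar_rdot Hdot_fiber !raddfD.
Qed.

Lemma Hspace_ae x y : sca1 x = sca1 y -> sca2 x = sca2 y ->
  {ae leb, forall t, (fib1 x) t = (fib1 y) t /\ (fib2 x) t = (fib2 y) t} -> x = y.
Proof.
case: x y => [[[x1 x2] f] g] [[[y1 y2] f'] g'] xy1 xy2 xy.
congr (_, _, _, _); [exact: xy1|exact: xy2|apply/L2P..].
  by apply: filterS xy => t [].
by apply: filterS xy => t [].
Qed.

(* The action of [scal1 + scal2 + (ent_ij)] on C + C + L^2[1, d]^2, with real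
   entries; only the values of [ent_ij] on [1, d] matter. *)
Record symbol := Symbol {
  scal1 : R; scal2 : R;
  ent11 : R -> R; ent12 : R -> R; ent21 : R -> R; ent22 : R -> R }.
Implicit Types s : symbol.

(** A relation holding almost everywhere, so that it passes to sums and composites by pointwise
    algebra and also applies to operators such as m(Q), whose definition involves no symbol. *)
Definition has_symbol G s := forall x,
  [/\ sca1 (G x) = (scal1 s)%:C * sca1 x,
      sca2 (G x) = (scal2 s)%:C * sca2 x &
      {ae leb, forall t,
        (fib1 (G x)) t = (ent11 s t)%:C * (fib1 x) t + (ent12 s t)%:C * (fib2 x) t /\
        (fib2 (G x)) t = (ent21 s t)%:C * (fib1 x) t + (ent22 s t)%:C * (fib2 x) t}].

(** Agreement is asked on [[1, d]], where [ell t ^+ 2 = t * (t - 1)] holds and the denominators [t]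
    and [2 t - 1] are positive. *)
Definition eq_symbol s s' := [/\ scal1 s = scal1 s', scal2 s = scal2 s' &
  forall t, 1 <= t <= d -> [/\ ent11 s t = ent11 s' t, ent12 s t = ent12 s' t,
    ent21 s t = ent21 s' t & ent22 s t = ent22 s' t]].

Definition symbol_add s s' := Symbol (scal1 s + scal1 s') (scal2 s + scal2 s')
  (fun t => ent11 s t + ent11 s' t) (fun t => ent12 s t + ent12 s' t)
  (fun t => ent21 s t + ent21 s' t) (fun t => ent22 s t + ent22 s' t).

Definition symbol_scale (k : R) s := Symbol (k * scal1 s) (k * scal2 s)
  (fun t => k * ent11 s t) (fun t => k * ent12 s t)
  (fun t => k * ent21 s t) (fun t => k * ent22 s t).

Definition symbol_mul s s' := Symbol (scal1 s * scal1 s') (scal2 s * scal2 s')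
  (fun t => ent11 s t * ent11 s' t + ent12 s t * ent21 s' t)
  (fun t => ent11 s t * ent12 s' t + ent12 s t * ent22 s' t)
  (fun t => ent21 s t * ent11 s' t + ent22 s t * ent21 s' t)
  (fun t => ent21 s t * ent12 s' t + ent22 s t * ent22 s' t).

Definition symbol_tr s :=
  Symbol (scal1 s) (scal2 s) (ent11 s) (ent21 s) (ent12 s) (ent22 s).

Definition symbol1 := Symbol 1 1 (cst 1) (cst 0) (cst 0) (cst 1).

Lemma has_symbol_inj G G' s s' :
  has_symbol G s -> has_symbol G' s' -> eq_symbol s s' -> G = G'.
Proof.
move=> Gs Gs' [e1 e2 e]; apply/funext => x.
have [g1 g2 g] := Gs x; have [g1' g2' g'] := Gs' x.
apply: Hspace_ae; [by rewrite g1 g1' e1|by rewrite g2 g2' e2|].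
apply: filterS3 g g' ae_itvco => t [-> ->] [-> ->] /andP[t1 /ltW td].
by have [|-> -> -> ->] := e t; rewrite ?t1.
Qed.

Lemma has_symbol_eq G s s' : has_symbol G s -> eq_symbol s s' -> has_symbol G s'.
Proof.
move=> Gs [e1 e2 e] x; have [g1 g2 g] := Gs x; rewrite -e1 -e2; split=> //.
apply: filterS2 g ae_itvco => t [-> ->] /andP[t1 /ltW td].
by have [|-> -> -> ->] := e t; rewrite ?t1.
Qed.

Lemma has_symbol_id : has_symbol id symbol1.
Proof.
move=> x; rewrite /= !mul1r; split=> //.
by apply: aeW => t; rewrite !mul1r !mul0r addr0 add0r.
Qed.

Lemma has_symbolD G G' s s' : has_symbol G s -> has_symbol G' s' ->
  has_symbol (G + G') (symbol_add s s').
Proof.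
move=> Gs Gs' x; have [g1 g2 g] := Gs x; have [g1' g2' g'] := Gs' x.
split; first by rewrite sca1D g1 g1' rmorphD mulrDl.
  by rewrite sca2D g2 g2' rmorphD mulrDl.
apply: filterS3 g g' (fibD (G x) (G' x)) => t [e1 e2] [e1' e2'] [h1 h2].
by split; [rewrite [LHS]h1 e1 e1'|rewrite [LHS]h2 e2 e2']; rewrite !rmorphD /=; ring.
Qed.

Lemma has_symbolZ (k : R) G s : has_symbol G s ->
  has_symbol (k%:C *: G) (symbol_scale k s).
Proof.
move=> Gs x; have [g1 g2 g] := Gs x.
split; first by rewrite sca1Z g1 rmorphM mulrA.
  by rewrite sca2Z g2 rmorphM mulrA.
apply: filterS2 g (fibZ k%:C (G x)) => t [e1 e2] [h1 h2].
by split; [rewrite [LHS]h1 e1|rewrite [LHS]h2 e2]; rewrite !rmorphM /=; ring.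
Qed.

Lemma has_symbol_comp G G' s s' : has_symbol G s -> has_symbol G' s' ->
  has_symbol (G \o G') (symbol_mul s s').
Proof.
move=> Gs Gs' x; have [g1 g2 g] := Gs (G' x); have [g1' g2' g'] := Gs' x.
split; first by rewrite /= g1 g1' rmorphM mulrA.
  by rewrite /= g2 g2' rmorphM mulrA.
apply: filterS2 g g' => t [e1 e2] [e1' e2'].
split; first by rewrite [LHS]e1 e1' e2' !rmorphD !rmorphM /=; ring.
by rewrite [LHS]e2 e1' e2' !rmorphD !rmorphM /=; ring.
Qed.

Lemma has_symbol_linear G s : has_symbol G s -> linear G.
Proof.
move=> Gs a x y; have [g1 g2 g] := Gs x; have [h1 h2 h] := Gs y.
have [k1 k2 k] := Gs (a *: x + y); apply: Hspace_ae.
- by rewrite -!/(sca1 _) k1 !sca1D !sca1Z g1 h1; ring.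
- by rewrite -!/(sca2 _) k2 !sca2D !sca2Z g2 h2; ring.
have gh : {ae leb, forall t,
    fib1 (a *: G x + G y) t = (ent11 s t)%:C * (a * fib1 x t + fib1 y t) +
      (ent12 s t)%:C * (a * fib2 x t + fib2 y t) /\
    fib2 (a *: G x + G y) t = (ent21 s t)%:C * (a * fib1 x t + fib1 y t) +
      (ent22 s t)%:C * (a * fib2 x t + fib2 y t)}.
  apply: filterS3 g h (fibP a (G x) (G y)) => t [-> ->] [-> ->] [-> ->].
  by split; ring.
apply: filterS3 k gh (fibP a x y) => t [k3 k4] [-> ->] [p1 p2].
by rewrite -!/(fib1 _) -!/(fib2 _) k3 k4 p1 p2.
Qed.

Lemma has_symbol_adjoint G G' s : has_symbol G s -> has_symbol G' (symbol_tr s) ->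
  is_adjoint Hdot G G'.
Proof.
move=> Gs Gs' x y; have [g1 g2 g] := Gs x; have [h1 h2 h] := Gs' y.
have realJ (k : R) (z : R[i]) : (k%:C * z)^*%R = k%:C * z^*%R.
  by rewrite rmorphM; congr (_ * _); exact: conjc_real.
have conjD (z w : R[i]) : (z + w)^*%R = z^*%R + w^*%R by rewrite rmorphD.
rewrite -[LHS]/(Hdot (G x) y) -[RHS]/(Hdot x (G' y)).
rewrite !Hdot_fiber g1 g2 h1 h2 !realJ; congr (_ + _ + _).
- by rewrite mulrCA mulrA.
- by rewrite mulrCA mulrA.
apply: ae_eq_Cintegral; [exact: Cintegrable_fiber_dot..|].
apply: filterS2 g h => t [e1 e2] [e1' e2'].
by rewrite /fiber_dot e1 e2 e1' e2' !conjD !realJ /=; ring.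
Qed.

(** A real matrix acts separately on real and imaginary parts, so a bound on real vectors [(p, q)],
    used once for each part, controls the complex fiber. *)
Lemma has_symbol_sqnorm_le G s (K : R) : has_symbol G s ->
  scal1 s ^+ 2 <= K ^+ 2 -> scal2 s ^+ 2 <= K ^+ 2 ->
  (forall t p q : R, 1 <= t <= d ->
    (ent11 s t * p + ent12 s t * q) ^+ 2 + (ent21 s t * p + ent22 s t * q) ^+ 2 <=
    K ^+ 2 * (p ^+ 2 + q ^+ 2)) ->
  forall x, sqnorm Hdot (G x) <= K ^+ 2 * sqnorm Hdot x.
Proof.
move=> Gs K1 K2 Ks x; have [g1 g2 g] := Gs x.
have sq (z : R[i]) : complex.Re (z * z^*%R) = complex.Re z ^+ 2 + complex.Im z ^+ 2.
  by case: z => u v /=; ring.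
have sqZ (k : R) (z : R[i]) :
    complex.Re (k%:C * z * (k%:C * z)^*%R) = k ^+ 2 * complex.Re (z * z^*%R).
  by rewrite !sq; case: z => u v /=; ring.
have sq_ge0 (z : R[i]) : 0 <= complex.Re (z * z^*%R).
  by rewrite sq addr_ge0 ?sqr_ge0.
rewrite /sqnorm !rdot_fiber mulrDr lerD//.
  by rewrite /scalar_rdot g1 g2 !sqZ mulrDr lerD// ler_wpM2r.
rewrite -RintegralZl//; last exact: integrable_fiber_rdot.
apply: Rintegral_ae_le; first exact: integrable_fiber_rdot.
  exact: (integrableZl measurableT (K ^+ 2) (integrable_fiber_rdot x x)).
apply: filterS2 g ae_itvco => t [e1 e2] /andP[t1 /ltW td].
rewrite /fiber_rdot /fiber_dot e1 e2 !raddfD /= !sq.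
have tE : 1 <= t <= d by rewrite t1.
case: ((fib1 x) t) ((fib2 x) t) => f1 f2 [h1 h2] /=.
have := Ks t f1 h1 tE; have := Ks t f2 h2 tE; nra.
Qed.

Lemma has_symbol_positive G s : has_symbol G s ->
  0 <= scal1 s -> 0 <= scal2 s -> ent12 s = ent21 s ->
  (forall t p q : R, 1 <= t <= d ->
    0 <= ent11 s t * p ^+ 2 + 2 * ent12 s t * p * q + ent22 s t * q ^+ 2) ->
  forall x, 0 <= Hdot (G x) x.
Proof.
move=> Gs s1 s2 s12 Gpos x; have [g1 g2 g] := Gs x.
(* In the order of [R[i]], positivity includes a vanishing imaginary part, which the symmetry of the
   symbol provides. *)
have sG : is_adjoint Hdot G G.
  apply: (has_symbol_adjoint Gs); case: (s) s12 (Gs) => ? ? ? ? ? ? /= ->.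
  by [].
have ImG : complex.Im (Hdot (G x) x) = 0.
  have e : Hdot (G x) x = (Hdot (G x) x)^*%R by rewrite [LHS]sG; exact: dotC.
  by move: e; case: (Hdot (G x) x) => u v /= [] /= ?; lra.
rewrite lecE ImG eqxx /=.
rewrite -[leRHS]/(rdot Hdot (G x) x) rdot_fiber addr_ge0//.
  rewrite /scalar_rdot g1 g2; case: (sca1 x) (sca2 x) => u v [u' v'] /=; nra.
apply: Rintegral_ae_ge0; first exact: integrable_fiber_rdot.
apply: filterS2 g ae_itvco => t [e1 e2] /andP[t1 /ltW td].
rewrite /fiber_rdot /fiber_dot e1 e2 !raddfD /= -s12.
have tE : 1 <= t <= d by rewrite t1.
case: ((fib1 x) t) ((fib2 x) t) => f1 f2 [h1 h2] /=.
have := Gpos t f1 h1 tE; have := Gpos t f2 h2 tE; nra.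
Qed.
End FiberwiseOperators.

(** * Operators with continuous symbols and their boundedness *)

Section SymbolOperators.
Context {R : realType} (d : R).
Local Notation leb := (leb_itv 1 d).
Implicit Types (x y : Hspace d) (G : Hspace d -> Hspace d) (s : @symbol R).

Definition symbol_op s : Hspace d -> Hspace d := fun x =>
  ((scal1 s)%:C * sca1 x, (scal2 s)%:C * sca2 x,
   mulop (fun t => (ent11 s t)%:C) (fib1 x) + mulop (fun t => (ent12 s t)%:C) (fib2 x),
   mulop (fun t => (ent21 s t)%:C) (fib1 x) + mulop (fun t => (ent22 s t)%:C) (fib2 x)).

Definition continuous_symbol s :=
  [/\ {within `[1, d], continuous (ent11 s)}, {within `[1, d], continuous (ent12 s)},
      {within `[1, d], continuous (ent21 s)} & {within `[1, d], continuous (ent22 s)}].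

Lemma continuous_on_real (f : R -> R) : {within `[1, d], continuous f} ->
  continuous_on 1 d (fun t => (f t)%:C).
Proof.
apply: (@within_continuous_comp R R R[i]^o _ f (fun t => t%:C)) => t _.
(* Continuity at [t] of the embedding of [R] into [R[i]] is that of [D0] on an interval around
   [t]. *)
apply: (@within_continuous_continuous _ _ R[i]^o (t - 1) (t + 1)).
- by lra.
- exact: D0_continuous.
- by rewrite in_itv /=; apply/andP; split; lra.
Qed.

Lemma symbol_opP s : continuous_symbol s -> has_symbol (symbol_op s) s.
Proof.
move=> [c11 c12 c21 c22] x; split=> //.
have h (a b : R -> R) : {within `[1, d], continuous a} ->
    {within `[1, d], continuous b} -> {ae leb, forall t,
      (mulop (fun t => (a t)%:C) (fib1 x) + mulop (fun t => (b t)%:C) (fib2 x) : L2 leb) t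
      = (a t)%:C * fib1 x t + (b t)%:C * fib2 x t}.
  move=> /continuous_on_real ca /continuous_on_real cb.
  have := L2_DE (mulop (fun t => (a t)%:C) (fib1 x)) (mulop (fun t => (b t)%:C) (fib2 x)).
  by apply: filterS3 (mulopE (fib1 x) ca) (mulopE (fib2 x) cb) => t -> -> ->.
by apply: filterS2 (h _ _ c11 c12) (h _ _ c21 c22) => t -> ->.
Qed.

Lemma within_itv_bounded (f : R -> R) : {within `[1, d], continuous f} ->
  exists2 M, 0 <= M & forall t, 1 <= t <= d -> `|f t| <= M.
Proof.
move=> cf.
have [M [_ Mf]] := compact_bounded (continuous_compact cf (@segment_compact _ 1 d)).
exists (Num.max 0 (M + 1)) => [|t td]; first by rewrite le_max lexx.
rewrite le_max; apply/orP; right; apply: Mf; first by rewrite ltrDl.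
by exists t => //=; rewrite in_itv.
Qed.

Lemma has_symbol_bounded G s :
  continuous_symbol s -> has_symbol G s -> bounded_op Hdot G.
Proof.
move=> [c11 c12 c21 c22] Gs.
have [M11 p11 b11] := within_itv_bounded c11.
have [M12 p12 b12] := within_itv_bounded c12.
have [M21 p21 b21] := within_itv_bounded c21.
have [M22 p22 b22] := within_itv_bounded c22.
pose B := M11 + M12 + M21 + M22 + `|scal1 s| + `|scal2 s|.
have n1 := normr_ge0 (scal1 s); have n2 := normr_ge0 (scal2 s).
have B0 : 0 <= B by rewrite /B; lra.
have sqB u : `|u| <= B -> u ^+ 2 <= B ^+ 2.
  by move=> uB; rewrite -(real_normK (num_real u)) lerXn2r ?nnegrE.
(* Entries bounded by [B] make each row contribute at most [2 B^2 (p^2 + q^2)]; the two rows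
   together give [(2 B)^2]. *)
apply: (@sqnorm_bounded_op _ _ _ _ (2 * B)).
- exact: has_symbol_linear Gs.
- by rewrite mulr_ge0.
apply: (has_symbol_sqnorm_le Gs).
- by apply: (@le_trans _ _ (B ^+ 2)); [apply: sqB; rewrite /B; lra|nra].
- by apply: (@le_trans _ _ (B ^+ 2)); [apply: sqB; rewrite /B; lra|nra].
move=> t p q td.
have s11 := sqB _ (le_trans (b11 t td) (_ : _ <= B)).
have {}s11 : ent11 s t ^+ 2 <= B ^+ 2 by apply: s11; rewrite /B; lra.
have s12 : ent12 s t ^+ 2 <= B ^+ 2.
  by apply: sqB; apply: (le_trans (b12 t td)); rewrite /B; lra.
have s21 : ent21 s t ^+ 2 <= B ^+ 2.
  by apply: sqB; apply: (le_trans (b21 t td)); rewrite /B; lra.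
have s22 : ent22 s t ^+ 2 <= B ^+ 2.
  by apply: sqB; apply: (le_trans (b22 t td)); rewrite /B; lra.
have aux (a b : R) : a ^+ 2 <= B ^+ 2 -> b ^+ 2 <= B ^+ 2 ->
    (a * p + b * q) ^+ 2 <= 2 * B ^+ 2 * (p ^+ 2 + q ^+ 2).
  move=> aB bB.
  have h1 := ler_wpM2r (sqr_ge0 p) aB; have h2 := ler_wpM2r (sqr_ge0 q) bB.
  have := sqr_ge0 (a * p - b * q); nra.
have := aux _ _ s11 s12; have := aux _ _ s21 s22; nra.
Qed.
End SymbolOperators.

(** * The matched projection *)

Section MatchedProjection.
Context {R : realType} (d : R).
Local Notation Hd := (Hspace d).
Local Notation Qd := (Qop d : Hd -> Hd).

Definition ell (t : R) := Num.sqrt (t * (t - 1)).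

Lemma ell_sqr t : 1 <= t -> ell t ^+ 2 = t * (t - 1).
Proof. by move=> t1; rewrite sqr_sqrtr// mulr_ge0//; lra. Qed.

Definition symbol_Q := Symbol 1 0 id (fun t => - ell t) ell (fun t => 1 - t).

(* [A = |Q^*|]: [A^2 = (2 t - 1) A = Q Q^*]. *)
Definition symbol_abs := Symbol 1 0 id ell ell (fun t => t - 1).

(* [A / (2 t - 1)], the projection onto the range of [A]. *)
Definition symbol_range := Symbol 1 0
  (fun t => t / (2 * t - 1)) (fun t => ell t / (2 * t - 1))
  (fun t => ell t / (2 * t - 1)) (fun t => (t - 1) / (2 * t - 1)).

(* [A / (2 t - 1)^2], the Moore-Penrose inverse of [A]. *)
Definition symbol_pinv := Symbol 1 0 (fun t => t / (2 * t - 1) ^+ 2)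
  (fun t => ell t / (2 * t - 1) ^+ 2) (fun t => ell t / (2 * t - 1) ^+ 2)
  (fun t => (t - 1) / (2 * t - 1) ^+ 2).

(* [1 - A / (2 t)], the inverse of [A + 1]. *)
Definition symbol_inv := Symbol 2^-1 1 (fun=> 2^-1) (fun t => - ell t / (2 * t))
  (fun t => - ell t / (2 * t)) (fun t => (t + 1) / (2 * t)).

Lemma within_ell : {within `[1, d], continuous ell}.
Proof.
apply: continuous_subspaceT => t.
apply: (@continuous_comp _ _ _ (fun t : R => t * (t - 1)) Num.sqrt).
  by apply: cvgM; [exact: cvg_id|apply: cvgB; [exact: cvg_id|exact: cvg_cst]].
exact: sqrt_continuous.
Qed.

Lemma within_affine (a b : R) : {within `[1, d], continuous (fun t => a * t + b)}.
Proof.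
apply: continuous_subspaceT => t; apply: cvgD; last exact: cvg_cst.
by apply: cvgM; [exact: cvg_cst|exact: cvg_id].
Qed.

Lemma eq_within (f g : R -> R) : f =1 g -> {within `[1, d], continuous f} ->
  {within `[1, d], continuous g}.
Proof. by move=> /funext ->. Qed.

Lemma within_mul (f g : R -> R) : {within `[1, d], continuous f} ->
  {within `[1, d], continuous g} -> {within `[1, d], continuous (fun t => f t * g t)}.
Proof. by move=> cf cg t; apply: cvgM; [exact: cf|exact: cg]. Qed.

Lemma within_opp (f : R -> R) : {within `[1, d], continuous f} ->
  {within `[1, d], continuous (fun t => - f t)}.
Proof. by move=> cf t; apply: cvgN; exact: cf. Qed.

Lemma within_affineV (a b : R) : 0 < a -> 0 < a + b ->
  {within `[1, d], continuous (fun t => (a * t + b)^-1)}.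
Proof.
move=> a0 ab; apply: continuous_in_subspaceT => t; rewrite mem_setE in_itv /=.
move=> /andP[t1 _]; apply: cvgV; first by apply/lt0r_neq0; nra.
apply: cvgD; last exact: cvg_cst.
by apply: cvgM; [exact: cvg_cst|exact: cvg_id].
Qed.

Lemma continuous_symbol_Q : continuous_symbol d symbol_Q.
Proof.
have cid : {within `[1, d], continuous (id : R -> R)}.
  by apply: continuous_subspaceT => t; exact: cvg_id.
split=> //=; [exact: within_opp within_ell|exact: within_ell|].
by apply: (eq_within _ (@within_affine (-1) 1)) => t; ring.
Qed.

Lemma continuous_symbol_abs : continuous_symbol d symbol_abs.
Proof.
have [? _ ? _] := continuous_symbol_Q.
by split=> //=; apply: (eq_within _ (@within_affine 1 (-1))) => t; ring.
Qed.

Lemma continuous_symbol_range : continuous_symbol d symbol_range.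
Proof.
have cV := within_affineV (a := 2) (b := -1).
have [? ? ? ?] := continuous_symbol_abs.
by split=> /=; apply: within_mul => //; apply: cV; lra.
Qed.

Lemma continuous_symbol_pinv : continuous_symbol d symbol_pinv.
Proof.
have cV : {within `[1, d], continuous (fun t : R => (2 * t - 1)^-1)}.
  by apply: within_affineV; lra.
have cV2 : {within `[1, d], continuous (fun t : R => ((2 * t - 1) ^+ 2)^-1)}.
  by apply: (eq_within _ (within_mul cV cV)) => t; rewrite expr2 invfM.
have [? ? ? ?] := continuous_symbol_abs.
by split=> /=; apply: within_mul.
Qed.

Lemma continuous_symbol_inv : continuous_symbol d symbol_inv.
Proof.
have cV : {within `[1, d], continuous (fun t : R => (2 * t)^-1)}.
  by apply: (eq_within _ (@within_affineV 2 0 _ _)) => [t||]; rewrite ?addr0//; lra.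
have cl := within_opp within_ell.
split=> /=; [|exact: within_mul..|apply: within_mul => //].
  by apply: continuous_subspaceT => t; exact: cvg_cst.
by apply: (eq_within _ (@within_affine 1 1)) => t; ring.
Qed.

Lemma has_symbol_Q : has_symbol Qd symbol_Q.
Proof.
have eN : (fun t => (- ell t)%:C) = - ellD0 by apply/funext => t; rewrite rmorphN.
have eB : (fun t => (1 - t)%:C) = (I0 - D0 : R -> R[i]).
  by apply/funext => t; rewrite rmorphB.
have -> : Qd = symbol_op symbol_Q.
  apply/funext => x; rewrite /Qop /dsum_op /symbol_op /= eN eB.
  by congr (_, _, _, _); rewrite ?mul0r.
exact: symbol_opP continuous_symbol_Q.
Qed.

Local Notation Qa := (symbol_op (symbol_tr symbol_Q) : Hd -> Hd).
Local Notation Aop := (symbol_op symbol_abs : Hd -> Hd).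
Local Notation Pop := (symbol_op symbol_range : Hd -> Hd).
Local Notation Xop := (symbol_op symbol_pinv : Hd -> Hd).
Local Notation Vop := (symbol_op symbol_inv : Hd -> Hd).

Lemma has_symbol_Qa : has_symbol Qa (symbol_tr symbol_Q).
Proof. by apply: symbol_opP; have [] := continuous_symbol_Q. Qed.

Let hQ := has_symbol_Q.
Let hQa := has_symbol_Qa.
Let hA := symbol_opP continuous_symbol_abs.
Let hP := symbol_opP continuous_symbol_range.
Let hX := symbol_opP continuous_symbol_pinv.
Let hV := symbol_opP continuous_symbol_inv.

Lemma adjoint_Q : adjoint Hdot Qd = Qa.
Proof.
apply: adjointE; last exact: has_symbol_adjoint hQ hQa.
by apply: has_symbol_bounded hQa; have [] := continuous_symbol_Q.
Qed.

Lemma adjoint_Qa : adjoint Hdot Qa = Qd.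
Proof.
apply: adjointE; last exact: has_symbol_adjoint hQa hQ.
by apply: has_symbol_bounded hQ; exact: continuous_symbol_Q.
Qed.

Lemma op_abs_Qa : op_abs Hdot Qa = Aop.
Proof.
(* The threshold [d]: on the range of [P], [A] acts as [2 t - 1], which lies between 1 and
   [2 d - 1], so that [|2 t - 1 - c| <= c - 1] once [c >= d]. *)
rewrite /op_abs adjoint_Qa; apply: (@op_sqrtE _ _ _ _ _ Pop d).
- split; first exact: has_symbol_bounded continuous_symbol_abs hA.
  apply: (has_symbol_positive hA) => //= t p q /andP[t1 _].
  rewrite -(@ler_pM2l _ t) ?mulr0; last by lra.
  rewrite [leRHS](_ : _ = (t * p + ell t * q) ^+ 2) ?sqr_ge0//.
  by have e := ell_sqr t1; ring: e.
- apply: has_symbol_inj (has_symbol_comp hA hA) (has_symbol_comp hQ hQa) _.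
  split=> //= t /andP[t1 _]; have e := ell_sqr t1.
  by split; ring: e.
- exact: has_symbol_linear hP.
- apply: has_symbol_inj (has_symbol_comp hA hP) hA _.
  split=> //=; rewrite ?mul1r ?mul0r// => t /andP[t1 _]; have e := ell_sqr t1.
  have w0 : 2 * t - 1 != 0 by apply/lt0r_neq0; lra.
  by split; field: e.
move=> c x dc; have sDP := has_symbolD hA (has_symbolZ (- c) hP).
rewrite (_ : _ - _ = (Aop + (- c)%:C *: Pop) x); last by rewrite rmorphN /= scaleNr.
apply: (has_symbol_sqnorm_le sDP) => /=.
- by rewrite mulr1 -[1 - c]opprB sqrrN.
- by rewrite mulr0 addr0 expr0n sqr_ge0.
move=> t p q /andP[t1 td]; have e := ell_sqr t1.
have w0 : 2 * t - 1 != 0 by apply/lt0r_neq0; lra.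
(* [P = A / (2 t - 1)] turns [A - c P] into [k A]. *)
pose k := 1 - c / (2 * t - 1).
have kE u : u + - c * (u / (2 * t - 1)) = k * u by rewrite /k; field.
rewrite !kE -!mulrA -!mulrDr !exprMn -mulrDr.
apply: (@le_trans _ _ (k ^+ 2 * ((2 * t - 1) ^+ 2 * (p ^+ 2 + q ^+ 2)))).
  apply: ler_wpM2l; first exact: sqr_ge0.
  (* Since [A^2 = (2 t - 1) A], the difference is [2 t - 1] times the form of [(2 t - 1) - A], which
     has rank one; the factor [t] makes the latter a perfect square. *)
  rewrite -subr_ge0 -(@pmulr_rge0 _ t); last by lra.
  rewrite [leRHS](_ : _ = (2 * t - 1) * (ell t * p - t * q) ^+ 2).
    by apply: mulr_ge0; [lra|exact: sqr_ge0].
  by ring: e.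
rewrite (_ : k ^+ 2 * _ = (2 * t - 1 - c) ^+ 2 * (p ^+ 2 + q ^+ 2)); last first.
  by rewrite /k; field.
by rewrite mulrA; apply: ler_wpM2r; [rewrite addr_ge0// sqr_ge0|nra].
Qed.

Lemma mp_inverse_A : mp_inverse Hdot Aop = Xop.
Proof.
apply: mp_inverseE; first exact: has_symbol_bounded continuous_symbol_pinv hX.
have sAX := has_symbol_comp hA hX; have sXA := has_symbol_comp hX hA.
have w0 (t : R) : 1 <= t -> 2 * t - 1 != 0 by move=> ?; apply/lt0r_neq0; lra.
split.
- apply: has_symbol_inj (has_symbol_comp sAX hA) hA _.
  split=> //=; rewrite ?mul1r ?mul0r// => t /andP[t1 _]; have e := ell_sqr t1.
  by have := w0 t t1; split; field: e.
- apply: has_symbol_inj (has_symbol_comp sXA hX) hX _.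
  split=> //=; rewrite ?mul1r ?mul0r// => t /andP[t1 _]; have e := ell_sqr t1.
  by have := w0 t t1; split; field: e.
- apply: (has_symbol_adjoint sAX); apply: (has_symbol_eq sAX).
  by split=> //= t /andP[t1 _]; have := w0 t t1; split; field.
- apply: (has_symbol_adjoint sXA); apply: (has_symbol_eq sXA).
  by split=> //= t /andP[t1 _]; have := w0 t t1; split; field.
Qed.

Lemma op_inv_A : op_inv Hdot (Aop + id) = Vop.
Proof.
have sA1 := has_symbolD hA (@has_symbol_id _ d).
apply: op_invE; first exact: has_symbol_bounded continuous_symbol_inv hV.
- apply: has_symbol_inj (has_symbol_comp sA1 hV) (@has_symbol_id _ d) _.
  split=> /=; [by field|by ring|move=> t /andP[t1 _]]; have e := ell_sqr t1.
  by have t0 : t != 0 by [apply/lt0r_neq0; lra]; split; field: e.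
- apply: has_symbol_inj (has_symbol_comp hV sA1) (@has_symbol_id _ d) _.
  split=> /=; [by field|by ring|move=> t /andP[t1 _]]; have e := ell_sqr t1.
  by have t0 : t != 0 by [apply/lt0r_neq0; lra]; split; field: e.
Qed.

(** [A + Q^*] has the single nonzero row [(2 t, 2 l)], and [A + Q] has its transpose as single
    nonzero column. This vector is an eigenvector of [A] for [2 t - 1], with squared length
    [4 t (2 t - 1)]. The corner entry is therefore [4 t (2 t - 1) / (2 (2 t - 1) (2 t)) = 1]. *)
Lemma has_symbol_matched_projection :
  has_symbol (matched_projection Hdot Qd) (Symbol 1 0 (cst 1) (cst 0) (cst 0) (cst 0)).
Proof.
rewrite /matched_projection adjoint_Q op_abs_Qa mp_inverse_A op_inv_A.
have half : 2^-1 = (2^-1 : R)%:C by rewrite fmorphV rmorph_nat.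
have sAQa := has_symbolD hA hQa; have sAQ := has_symbolD hA hQ.
rewrite half; apply: has_symbol_eq (has_symbolZ _ (has_symbol_comp
  (has_symbol_comp (has_symbol_comp sAQa hX) hV) sAQ)) _.
split=> /=; [by field|by ring|move=> t /andP[t1 _]]; have e := ell_sqr t1.
have t0 : t != 0 by apply/lt0r_neq0; lra.
have w0 : 2 * t - 1 != 0 by apply/lt0r_neq0; lra.
by split; field: e; rewrite t0.
Qed.

Lemma has_symbol_T :
  let m := matched_projection Hdot Qd in
  has_symbol (m + (m \o Qd))
    (Symbol 2 0 (fun t => 1 + t) (fun t => - ell t) (cst 0) (cst 0)).
Proof.
have sM := has_symbol_matched_projection.
apply: has_symbol_eq (has_symbolD sM (has_symbol_comp sM hQ)) _.
by split=> /=; [ring|ring|move=> t _; split; ring].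
Qed.

End MatchedProjection.

(** * The numerical range *)

Section SupportingLines.
Context {R : realType} (d : R).
Hypothesis d_gt1 : 1 < d.
Variables (T : Hspace d -> Hspace d) (al be : R).
Hypothesis sT :
  has_symbol T (Symbol 2 0 (fun t => 1 + t) (fun t => - ell t) (cst 0) (cst 0)).
(* [(al, be)] runs over the unit sphere of the norm dual to the one whose unit
   ball is the ellipse, centered at 0. *)
Hypothesis dual_unit :
  al ^+ 2 * ((2 * d ^+ 2 + d + 1) / 4) + be ^+ 2 * (d * (d - 1) / 4) = 1.
Let c : R := (1 + d) / 2.
Implicit Types (x : Hspace d).

(** The foci 0 and [2 c] of the ellipse lie strictly on the inner side of the supporting line
    [al X + be Y = 1 + al c]. By [a^2 = c^2 + b^2], [dual_unit] says that [(al c)^2] falls short of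
    1 by [(al^2 + be^2) b^2]. *)
Lemma dual_bounds : -1 < al * c < 1.
Proof.
have d1 := d_gt1; have e : (al * c) ^+ 2 + (al ^+ 2 + be ^+ 2) * (d * (d - 1) / 4) = 1.
  by rewrite -[RHS]dual_unit /c; field.
suff : (al * c) ^+ 2 < 1 by move=> ?; apply/andP; split; nra.
have [al0|al0] := eqVneq al 0; first by rewrite al0 mul0r expr0n.
have : 0 < (al ^+ 2 + be ^+ 2) * (d * (d - 1) / 4).
  apply: mulr_gt0; first by rewrite ltr_pwDl ?sqr_ge0// exprn_even_gt0.
  by rewrite divr_gt0// mulr_gt0 ?subr_gt0// (lt_trans ltr01).
by move=> h; rewrite -[ltRHS]e ltrDl.
Qed.

(** The scalar eigenvalue 2 lies between the foci 0 and [1 + d], hence on the same side of the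
    line. *)
Lemma dual_bounds2 : 0 < 1 + al * c - 2 * al.
Proof.
have d1 := d_gt1; have /andP[h1 h2] := dual_bounds; have c1 : 1 <= c by rewrite /c; lra.
have [al0|al0] := lerP al 0; first by lra.
by have : al <= al * c; [rewrite ler_pMr|lra].
Qed.

(* The determinant is a concave quadratic polynomial in [t] that is positive at
   [t = 1] and vanishes at [t = d]. *)
Lemma fiber_det_gt0 t : 1 <= t < d ->
  0 < (1 + al * c - al * (1 + t)) * (1 + al * c) -
      t * (t - 1) * (al ^+ 2 + be ^+ 2) / 4.
Proof.
move=> /andP[t1 td]; have /andP[al1 _] := dual_bounds; have al2 := dual_bounds2.
have d10 : 0 < d - 1 by rewrite subr_gt0.
rewrite -(pmulr_rgt0 _ d10).
set g := al ^+ 2 + be ^+ 2; have g0 : 0 <= g by rewrite addr_ge0// sqr_ge0.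
(* Interpolation of the determinant at 1 and [d]; the second term carries its leading coefficient
   [- g / 4]. The two sides differ by a multiple of the defect in [dual_unit]. *)
rewrite [ltRHS](_ : _ = (d - t) * ((1 + al * c - 2 * al) * (1 + al * c)) +
    (d - 1) * (t - 1) * (d - t) * g / 4).
  apply: ltr_pwDl; first by rewrite !mulr_gt0//; lra.
  by rewrite divr_ge0// !mulr_ge0//; lra.
apply/eqP; rewrite -subr_eq0; apply/eqP.
transitivity ((t - 1) * (1 - (al ^+ 2 * ((2 * d ^+ 2 + d + 1) / 4) +
    be ^+ 2 * (d * (d - 1) / 4)))); first by rewrite /g /c; field.
by rewrite dual_unit subrr mulr0.
Qed.

(** [form] is [(1 + al c) |z|^2 - al Re <T z, z> - be Im <T z, z>] on the fiber at [t], for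
    [z = (f1 + i f2, g1 + i g2)]. Completing the square in the second coordinate leaves the
    determinant as coefficient of the first. *)
Lemma fiber_form_ge0 t (f1 f2 g1 g2 : R) : 1 <= t < d ->
  let form := (1 + al * c - al * (1 + t)) * (f1 ^+ 2 + f2 ^+ 2) +
    (1 + al * c) * (g1 ^+ 2 + g2 ^+ 2) +
    ell t * (al * (g1 * f1 + g2 * f2) + be * (g2 * f1 - g1 * f2)) in
  0 <= form /\ (form = 0 -> [/\ f1 = 0, f2 = 0, g1 = 0 & g2 = 0]).
Proof.
move=> td form; have det0 := fiber_det_gt0 td; have /andP[t1 _] := td.
have /andP[al1 _] := dual_bounds; have e := ell_sqr t1.
set D := _ - _ in det0; set B := 1 + al * c; have B0 : 0 < B by rewrite /B; lra.
have E : B * form = (B * g1 + ell t / 2 * (al * f1 - be * f2)) ^+ 2 +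
    (B * g2 + ell t / 2 * (al * f2 + be * f1)) ^+ 2 + D * (f1 ^+ 2 + f2 ^+ 2).
  by rewrite /form /D /B; field: e.
have fD0 : 0 <= D * (f1 ^+ 2 + f2 ^+ 2).
  by rewrite mulr_ge0 ?(ltW det0)// addr_ge0 ?sqr_ge0.
have s1 := sqr_ge0 (B * g1 + ell t / 2 * (al * f1 - be * f2)).
have s2 := sqr_ge0 (B * g2 + ell t / 2 * (al * f2 + be * f1)).
split; first by rewrite -(pmulr_rge0 _ B0) E !addr_ge0.
move=> form0; move: E; rewrite form0 mulr0 => E.
have /eqP : D * (f1 ^+ 2 + f2 ^+ 2) = 0 by lra.
rewrite mulf_eq0 (gt_eqF det0) /= paddr_eq0 ?sqr_ge0// !sqrf_eq0.
move=> /andP[/eqP f10 /eqP f20].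
move: E s1 s2; rewrite f10 f20 !mulr0 !addr0 subr0 mulr0 !addr0 expr0n addr0 mulr0 addr0.
rewrite !exprMn => E s1 s2; have B2 : 0 < B ^+ 2 by rewrite exprn_gt0.
have /eqP : B ^+ 2 * g1 ^+ 2 = 0 by lra.
rewrite mulf_eq0 (gt_eqF B2) /= sqrf_eq0 => /eqP ->.
have /eqP : B ^+ 2 * g2 ^+ 2 = 0 by lra.
by rewrite mulf_eq0 (gt_eqF B2) /= sqrf_eq0 => /eqP ->.
Qed.

(** The gap between the two sides is a sum of positive definite scalar terms and the integral of
    fiber forms that are definite for almost every [t]. If it vanished, so would every component of
    [x]. *)
Lemma support_lt x : x != 0 ->
  al * complex.Re (Hdot (T x) x) + be * complex.Im (Hdot (T x) x) <
  (1 + al * c) * sqnorm Hdot x.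
Proof.
(* [Re (w z) = - (al Re z + be Im z)], so that [Re <y, x>] is the gap. *)
move=> x0; pose w : R[i] := (- al) +i* be.
pose y := (1 + al * c)%:C *: x + w *: T x.
have [t1 t2 tf] := sT x.
have yE : rdot Hdot y x = (1 + al * c) * sqnorm Hdot x -
    (al * complex.Re (Hdot (T x) x) + be * complex.Im (Hdot (T x) x)).
  rewrite rdotDl rdotZl; congr (_ + _).
  rewrite /rdot linearZl_LR /= -[_ x]/(Hdot (T x) x).
  by case: (Hdot (T x) x) => u v /=; ring.
rewrite -subr_gt0 -yE rdot_fiber.
have al2 := dual_bounds2; have /andP[al1 _] := dual_bounds.
have sq (z : R[i]) : 0 <= complex.Re z ^+ 2 + complex.Im z ^+ 2.
  by rewrite addr_ge0 ?sqr_ge0.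
have scalE : scalar_rdot y x =
    (1 + al * c - 2 * al) * (complex.Re (sca1 x) ^+ 2 + complex.Im (sca1 x) ^+ 2) +
    (1 + al * c) * (complex.Re (sca2 x) ^+ 2 + complex.Im (sca2 x) ^+ 2).
  rewrite /scalar_rdot !sca1D !sca2D !sca1Z !sca2Z t1 t2.
  by case: (sca1 x) (sca2 x) => u v [u' v'] /=; ring.
have fibE : {ae leb_itv 1 d, forall t, 1 <= t < d /\ fiber_rdot y x t =
  (1 + al * c - al * (1 + t)) *
    (complex.Re (fib1 x t) ^+ 2 + complex.Im (fib1 x t) ^+ 2) +
  (1 + al * c) * (complex.Re (fib2 x t) ^+ 2 + complex.Im (fib2 x t) ^+ 2) +
  ell t * (al * (complex.Re (fib2 x t) * complex.Re (fib1 x t) +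
                 complex.Im (fib2 x t) * complex.Im (fib1 x t)) +
           be * (complex.Im (fib2 x t) * complex.Re (fib1 x t) -
                 complex.Re (fib2 x t) * complex.Im (fib1 x t)))}.
  have h1 := fibP (1 + al * c)%:C x (w *: T x); have h2 := fibZ w (T x).
  have h : {ae leb_itv 1 d, forall t,
      fib1 y t = (1 + al * c)%:C * fib1 x t + w * fib1 (T x) t /\
      fib2 y t = (1 + al * c)%:C * fib2 x t + w * fib2 (T x) t}.
    by apply: filterS2 h1 h2 => t [e1 e2] [<- <-].
  apply: filterS3 h tf (ae_itvco d) => t [y1 y2] [e1 e2] td; split=> //.
  rewrite /fiber_rdot /fiber_dot y1 y2 e1 e2 /=.
  by case: (fib1 x t) (fib2 x t) => f1 f2 [g1 g2] /=; ring.
have scal_ge0 : 0 <= scalar_rdot y x.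
  by rewrite scalE addr_ge0// mulr_ge0// ?sq//; lra.
have fib_ge0 : {ae leb_itv 1 d, forall t, 0 <= fiber_rdot y x t}.
  apply: filterS2 tf fibE => t _ [td ->].
  by have [] := fiber_form_ge0 (complex.Re (fib1 x t)) (complex.Im (fib1 x t))
    (complex.Re (fib2 x t)) (complex.Im (fib2 x t)) td.
have int_ge0 := Rintegral_ae_ge0 (integrable_fiber_rdot y x) fib_ge0.
rewrite lt_neqAle addr_ge0// andbT eq_sym; apply: contra_neqN x0 => /eqP.
move=> sum0; have scal0 : scalar_rdot y x = 0 by lra.
have int0 : \int[leb_itv 1 d]_t fiber_rdot y x t = 0 by lra.
have fib0 := Rintegral_ae_eq0 (integrable_fiber_rdot y x) fib_ge0 int0.
have eq0 (z : R[i]) : complex.Re z ^+ 2 + complex.Im z ^+ 2 = 0 -> z = 0.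
  case: z => u v /= /eqP; rewrite paddr_eq0 ?sqr_ge0// !sqrf_eq0.
  by move=> /andP[/eqP -> /eqP ->].
have B0 : 0 < 1 + al * c by lra.
have n1 := mulr_ge0 (ltW al2) (sq (sca1 x)); have n2 := mulr_ge0 (ltW B0) (sq (sca2 x)).
apply: Hspace_ae.
- apply: eq0; apply/eqP; have /eqP : (1 + al * c - 2 * al) *
    (complex.Re (sca1 x) ^+ 2 + complex.Im (sca1 x) ^+ 2) = 0 by lra.
  by rewrite mulf_eq0 (gt_eqF al2).
- apply: eq0; apply/eqP; have /eqP : (1 + al * c) *
    (complex.Re (sca2 x) ^+ 2 + complex.Im (sca2 x) ^+ 2) = 0 by lra.
  by rewrite mulf_eq0 (gt_eqF B0).
have z0 : {ae leb_itv 1 d, forall t,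
    fib1 (0 : Hspace d) t = 0 /\ fib2 (0 : Hspace d) t = 0}.
  by apply: filterS (L2_0E (leb_itv 1 d)) => t.
apply: filterS3 z0 fibE fib0 => t [z1 z2] [td ->] form0.
have [_ /(_ form0)] := fiber_form_ge0
    (complex.Re (fib1 x t)) (complex.Im (fib1 x t))
    (complex.Re (fib2 x t)) (complex.Im (fib2 x t)) td.
by rewrite z1 ?z2; case: (fib1 x t) (fib2 x t) => f1 f2 [g1 g2] /= [-> -> -> ->].
Qed.

End SupportingLines.

(** * Estimates for multiplication operators, and indicator functions in L^2 *)

Section L2Space.
Context d (T : measurableType d) (R : realType) (mu : {measure set T -> \bar R}).

Lemma L2dot_ae_ge0 (u v : L2 mu) :
  {ae mu, forall t, 0 <= u t * (v t)^*%R} -> 0 <= L2dot u v.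
Proof.
move=> uv; have [ri ii] := sqintegrable_mul (L2_sqintegrable u) (L2_sqintegrable v).
rewrite lecE /= Rintegral_ae_ge0//; last first.
  by apply: filterS uv => t; rewrite lecE => /andP[].
rewrite andbT; apply/eqP/le_anti/andP; split.
  rewrite -oppr_ge0 -[X in _ <= X]mulN1r -RintegralZl//.
  apply: Rintegral_ae_ge0; first by have := integrableZl measurableT (-1) ii.
  by apply: filterS uv => t /ger0_Im /= ->; rewrite mulr0.
apply: Rintegral_ae_ge0 => //.
by apply: filterS uv => t /ger0_Im /= ->.
Qed.

Lemma L2dotZl (k : R[i]) (u v : L2 mu) : L2dot (k *: u) v = k * L2dot u v.
Proof. exact: linearZl_LR. Qed.

Lemma L2dotZr (k : R[i]) (u v : L2 mu) : L2dot u (k *: v) = k^*%R * L2dot u v.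
Proof. exact: linearZr_LR. Qed.

Lemma L2_ZBE (k l : R[i]) (u v : L2 mu) :
  {ae mu, forall t, (k *: u - l *: v : L2 mu) t = k * u t - l * v t}.
Proof.
have e : {ae mu, forall t, (- (l *: v) : L2 mu) t = - (l * v t)}.
  by apply: filterS2 (L2_NE (l *: v)) (L2_ZE l v) => t -> ->.
by apply: filterS3 (L2_DE (k *: u) (- (l *: v))) (L2_ZE k u) e => t -> -> ->.
Qed.

(** Serves to locate the means of [1 + t] and [ell] against a unit vector supported near [d]; these
    means stand in for the values at [d]. *)
Lemma L2dot_mul_ge (a : T -> R) (m : R) (psi phi : L2 mu) :
  {ae mu, forall t, phi t = (a t)%:C * psi t} ->
  {ae mu, forall t, psi t != 0 -> m <= a t} ->
  m%:C * L2dot psi psi <= L2dot phi psi.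
Proof.
move=> phiE am; rewrite -subr_ge0 -L2dotZl.
have -> : L2dot phi psi - L2dot (m%:C *: psi) psi = L2dot (phi - m%:C *: psi) psi.
  by rewrite linearBl.
apply: L2dot_ae_ge0.
apply: filterS3 phiE am (L2_ZBE 1 m%:C phi psi) => t.
rewrite scale1r => -> am ->; rewrite mul1r.
have [->|/am amt] := eqVneq (psi t) 0; first by rewrite !mulr0 subrr mul0r.
rewrite -mulrBl -rmorphB -mulrA mulr_ge0 ?mul_conjC_ge0//.
by rewrite ler0c subr_ge0.
Qed.

Lemma L2dot_mul_le (a : T -> R) (m : R) (psi phi : L2 mu) :
  {ae mu, forall t, phi t = (a t)%:C * psi t} ->
  {ae mu, forall t, psi t != 0 -> a t <= m} ->
  L2dot phi psi <= m%:C * L2dot psi psi.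
Proof.
move=> phiE am; rewrite -lerN2 -mulNr -rmorphN.
have -> : - L2dot phi psi = L2dot (- phi) psi by rewrite linearNl.
apply: (@L2dot_mul_ge (fun t => - a t)).
  by apply: filterS2 (L2_NE phi) phiE => t -> ->; rewrite rmorphN mulNr.
by apply: filterS am => t /[apply]; rewrite lerN2.
Qed.

Lemma sqintegrable_indic (A : set T) : measurable A -> (mu A < +oo)%E ->
  sqintegrable mu (fun t => (\1_A t)%:C).
Proof.
move=> mA Aoo; apply/andP; split; last first.
  exact: (@Lfun_submod_closed _ T R mu _ (lee1n 2)).1.
apply/andP; rewrite !inE/=; split; first exact: measurable_indic.
rewrite /finite_norm unlock poweR_lty//.
rewrite (eq_integral (fun t => (\1_A t)%:E)) ?integral_indic ?setIT// => t _ /=.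
by rewrite indicE; case: (t \in A); rewrite ?normr1 ?powR1// normr0 powR0.
Qed.

Lemma L2dot_indic (A : set T) : measurable A -> (mu A < +oo)%E ->
  let u := toL2 mu (fun t => (\1_A t)%:C) in L2dot u u = (fine (mu A))%:C.
Proof.
move=> mA Aoo /=; have si := sqintegrable_indic mA Aoo.
transitivity (Cintegral mu (fun t => (\1_A t)%:C * ((\1_A t)%:C)^*%R)).
  apply: ae_eq_Cintegral; [|exact: (sqintegrable_mul si si)|].
    by apply: sqintegrable_mul; exact: L2_sqintegrable.
  by apply: filterS (toL2K si) => t ->.
congr (_ +i* _).
  rewrite /Rintegral (eq_integral (fun t => (\1_A t)%:E)) ?integral_indic ?setIT//.
  move=> t _ /=.
  by rewrite mul0r subr0 indicE; case: (t \in A); rewrite ?mulr1 ?mulr0.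
rewrite /Rintegral (eq_integral (cst 0%E)) ?integral0// => t _ /=.
by rewrite oppr0 mulr0 mul0r addr0.
Qed.

End L2Space.

(** * The two inclusions between the numerical range and the open ellipse *)

Section NumericalRange.
Context {R : realType} (d : R).
Local Notation leb := (leb_itv 1 d).

Lemma exists_unit_L2 (s : R) : 1 <= s < d -> exists psi : L2 leb,
  L2dot psi psi = 1 /\ {ae leb, forall t, psi t != 0 -> s <= t <= d}.
Proof.
move=> /andP[s1 sd]; pose A : set R := `[s, d]%classic.
have mA : measurable (A : set (measurableTypeR R)) by exact: measurable_itv.
have muA : leb A = (d - s)%:E.
  rewrite /leb_itv/= /mrestr setIidl.
    by rewrite lebesgue_measure_itv /= lte_fin sd.
  by move=> t; rewrite /A /= !in_itv /= => /andP[st ->]; rewrite (le_trans s1 st).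
have Aoo : (leb A < +oo)%E by rewrite muA ltry.
pose u := toL2 leb (fun t => (\1_A t)%:C).
have k0 : 0 < Num.sqrt (d - s) by rewrite sqrtr_gt0 subr_gt0.
exists (((Num.sqrt (d - s))^-1)%:C *: u); split.
  rewrite L2dotZl L2dotZr L2dot_indic// muA /= [X in _ * (X * _)]conjc_real.
  rewrite -!rmorphM -[X in _ * (_ * X)](sqr_sqrtr (ltW _)) ?subr_gt0//.
  by rewrite expr2 mulKf ?mulVf// gt_eqF.
have := L2_ZE ((Num.sqrt (d - s))^-1)%:C u.
apply: filterS2 (toL2K (sqintegrable_indic mA Aoo)) => t e ->.
rewrite e indicE; have [/set_mem|] := boolP (t \in A); last by rewrite mulr0 eqxx.
by rewrite /A /= in_itv.
Qed.

Variables (T : Hspace d -> Hspace d).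
Hypothesis d_gt1 : 1 < d.
Hypothesis sT :
  has_symbol T (Symbol 2 0 (fun t => 1 + t) (fun t => - ell t) (cst 0) (cst 0)).
Let c : R := (1 + d) / 2.
Let a2 : R := (2 * d ^+ 2 + d + 1) / 4.
Let b2 : R := d * (d - 1) / 4.

Lemma numerical_range_sub_ellipse x : sqnorm Hdot x = 1 ->
  (complex.Re (Hdot (T x) x) - c) ^+ 2 / a2 + complex.Im (Hdot (T x) x) ^+ 2 / b2 < 1.
Proof.
move=> x1; set X := complex.Re _; set Y := complex.Im _; have d1 := d_gt1.
have a0 : 0 < a2 by rewrite /a2; nra.
have b0 : 0 < b2 by rewrite /b2; nra.
rewrite ltNge; apply/negP; set S := _ + _ => S1.
pose rho := Num.sqrt S; have rho2 : rho ^+ 2 = S by rewrite sqr_sqrtr//; lra.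
have rho1 : 1 <= rho by rewrite -(@ler_sqr R) ?nnegrE ?sqrtr_ge0// expr1n rho2.
(* [rho] is the gauge of [(X - c, Y)], and [(al, be)] is the dual unit vector norming it:
   [al (X - c) + be Y = rho]. With [rho >= 1] this contradicts [support_lt]. *)
pose al := (X - c) / (a2 * rho); pose be := Y / (b2 * rho).
have rho_neq0 : rho != 0 by apply/lt0r_neq0; lra.
have aN := lt0r_neq0 a0; have bN := lt0r_neq0 b0.
have dual : al ^+ 2 * a2 + be ^+ 2 * b2 = 1.
  rewrite (_ : _ + _ = S / rho ^+ 2); first by rewrite rho2 divff// gt_eqF//; lra.
  by rewrite /al /be /S; field; rewrite rho_neq0 bN.
have x0 : x != 0.
  by apply: contra_eqN x1 => /eqP ->; rewrite /sqnorm /rdot linear0r eq_sym oner_eq0.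
have := support_lt d_gt1 sT dual x0; rewrite x1 mulr1 -/X -/Y -/c.
suff : al * (X - c) + be * Y = rho by rewrite mulrBr; lra.
rewrite (_ : _ + _ = S / rho); first by rewrite -rho2 expr2 mulfK.
by rewrite /al /be /S; field; rewrite rho_neq0 bN.
Qed.

(* The test vector is [(0, *, sqrt h psi, q psi)] with [psi] concentrated on
   [s, d]; as [T] kills the second copy of C, the coordinate [*] is free to bring
   the norm up to 1. *)
Lemma exists_unit_vector (h s X Y : R) : 0 < h < 1 -> 1 < s < d ->
  (Num.sqrt ((h * (1 + d) - X) ^+ 2 + Y ^+ 2) + h * (d - s)) ^+ 2 <=
    h * (1 - h) * (s * (s - 1)) ->
  exists2 x, sqnorm Hdot x = 1 & Hdot (T x) x = X +i* Y.
Proof.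
move=> /andP[h0 h1] /andP[s1 sd]; set N := Num.sqrt _ => N_le.
have N2 : N ^+ 2 = (h * (1 + d) - X) ^+ 2 + Y ^+ 2.
  by rewrite sqr_sqrtr// addr_ge0 ?sqr_ge0.
have N0 : 0 <= N by rewrite sqrtr_ge0.
have [|psi [psi1 psi_supp]] := @exists_unit_L2 s; first by rewrite sd ltW.
have c1 : {within `[1, d], continuous (fun t : R => 1 + t)}.
  by apply: (eq_within _ (@within_affine _ d 1 1)) => t; ring.
pose phi1 := mulop (fun t => (1 + t)%:C) psi.
pose phi2 := mulop (fun t => (ell t)%:C) psi.
have phi1E := mulopE psi (continuous_on_real c1).
have phi2E := mulopE psi (continuous_on_real (@within_ell _ d)).
have K_ge : (1 + s)%:C <= L2dot phi1 psi.
  rewrite -[leLHS]mulr1 -psi1; apply: L2dot_mul_ge phi1E _.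
  by apply: filterS psi_supp => t /[apply] /andP[st _]; rewrite lerD2l.
have K_le : L2dot phi1 psi <= (1 + d)%:C.
  rewrite -[leRHS]mulr1 -psi1; apply: L2dot_mul_le phi1E _.
  by apply: filterS psi_supp => t /[apply] /andP[_ td]; rewrite lerD2l.
have L_ge : (ell s)%:C <= L2dot phi2 psi.
  rewrite -[leLHS]mulr1 -psi1; apply: L2dot_mul_ge phi2E _.
  apply: filterS psi_supp => t /[apply] /andP[st _].
  by rewrite ler_sqrt; nra.
have [K KE] : exists K : R, L2dot phi1 psi = K%:C.
  exists (complex.Re (L2dot phi1 psi)); apply/esym/RRe_real/ger0_real.
  by apply: le_trans K_ge; rewrite ler0c; lra.
have [L LE] : exists L : R, L2dot phi2 psi = L%:C.
  exists (complex.Re (L2dot phi2 psi)); apply/esym/RRe_real/ger0_real.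
  by apply: le_trans L_ge; rewrite ler0c sqrtr_ge0.
move: K_ge K_le L_ge; rewrite KE LE !lecR => K_ge K_le L_ge.
have ells : ell s ^+ 2 = s * (s - 1) by rewrite ell_sqr// ltW.
have L0 : 0 < L by apply: lt_le_trans L_ge; rewrite sqrtr_gt0; nra.
(* Solves [h K - sqrt h (u + i v) L = X + i Y], whose left-hand side is [<T x, x>] for the test
   vector. *)
pose u := (h * K - X) / (Num.sqrt h * L); pose v := - Y / (Num.sqrt h * L).
have hh : Num.sqrt h ^+ 2 = h by rewrite sqr_sqrtr// ltW.
have sh0 : 0 < Num.sqrt h by rewrite sqrtr_gt0.
have PN : - (h * (1 + d) - X) <= N.
  by rewrite ler_normlW// normrN -sqrtr_sqr ler_wsqrtr// lerDl sqr_ge0.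
(* This is the condition [h + u^2 + v^2 <= 1]. Replacing [K] by [1 + d] costs at most [h (d - s)] in
   the triangle inequality, and [L] is at least [ell s]. *)
have hKX : (h * K - X) ^+ 2 + Y ^+ 2 <= h * (1 - h) * L ^+ 2.
  have dl0 : 0 <= h * (1 + d - K) by rewrite mulr_ge0 ?(ltW h0)// subr_ge0.
  have dls : h * (1 + d - K) <= h * (d - s) by rewrite ler_wpM2l ?(ltW h0)//; lra.
  apply: (@le_trans _ _ ((N + h * (1 + d - K)) ^+ 2)).
    have := ler_wpM2l dl0 PN; rewrite [(N + _) ^+ 2]sqrrD N2; lra.
  apply: (@le_trans _ _ ((N + h * (d - s)) ^+ 2)).
    by rewrite lerXn2r ?nnegrE ?addr_ge0 ?lerD2l//; apply: le_trans dls.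
  apply: (le_trans N_le); apply: ler_wpM2l.
    by apply: mulr_ge0; [exact: ltW|rewrite subr_ge0 ltW].
  by rewrite -ells lerXn2r ?nnegrE ?sqrtr_ge0// ltW.
have uvE : h + u ^+ 2 + v ^+ 2 <= 1.
  have -> : h + u ^+ 2 + v ^+ 2 = h + ((h * K - X) ^+ 2 + Y ^+ 2) / (h * L ^+ 2).
    by rewrite /u /v !expr_div_n !exprMn hh sqrrN mulrDl addrA.
  rewrite -lerBrDl ler_pdivrMr ?mulr_gt0 ?exprn_gt0//.
  by rewrite mulrA [_ * h]mulrC.
pose sg := Num.sqrt (1 - (h + u ^+ 2 + v ^+ 2)).
have sgE : sg ^+ 2 = 1 - (h + u ^+ 2 + v ^+ 2) by rewrite sqr_sqrtr// subr_ge0.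
pose x : Hspace d := (0, sg%:C, (Num.sqrt h)%:C *: psi, (u +i* v) *: psi).
pose w : L2 leb := (Num.sqrt h)%:C *: phi1 - (u +i* v) *: phi2.
pose y : Hspace d := (0, 0, w, 0).
have TxE : T x = y.
  have [t1 t2 tf] := sT x; apply: Hspace_ae.
  - by rewrite t1 /sca1 /= mulr0.
  - by rewrite t2 /sca2 /= mul0r.
  have wE : {ae leb, forall t, w t = (Num.sqrt h)%:C * ((1 + t)%:C * psi t) -
      (u +i* v) * ((ell t)%:C * psi t)}.
    have := L2_ZBE (Num.sqrt h)%:C (u +i* v) phi1 phi2.
    by apply: filterS3 phi1E phi2E => t <- <-.
  have xE : {ae leb, forall t, fib1 x t = (Num.sqrt h)%:C * psi t /\
      fib2 x t = (u +i* v) * psi t}.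
    exact: filterS2 (L2_ZE (Num.sqrt h)%:C psi) (L2_ZE (u +i* v) psi).
  have w0E : {ae leb, forall t, w t = (Num.sqrt h)%:C * ((1 + t)%:C * psi t) -
      (u +i* v) * ((ell t)%:C * psi t) /\ (0 : L2 leb) t = 0}.
    by apply: filterS2 wE (L2_0E leb) => t.
  apply: filterS3 tf xE w0E => t [e1 e2] [x1 x2] [w1 w2].
  rewrite -!/(fib1 _) -!/(fib2 _) e1 e2 x1 x2.
  rewrite -[fib1 y t]/(w t) -[fib2 y t]/((0 : L2 leb) t) w1 w2 /=.
  by split; [rewrite rmorphN; ring|ring].
have conjR (k : R) : (k%:C)^*%R = k%:C :> R[i] by exact: conjc_real.
exists x.
  apply: complexI; rewrite -sqnormE -[LHS]/(Hdot x x) /Hdot /x /=.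
  rewrite !L2dotZl !L2dotZr psi1 !conjR mul0r add0r !mulr1 -!rmorphM -!expr2 sgE hh.
  by apply/eqP; rewrite eq_complex /=; apply/andP; split; apply/eqP; ring.
rewrite TxE /Hdot /x /y /= !mul0r !add0r linear0l addr0 L2dotZr conjR.
have -> : L2dot w psi =
    (Num.sqrt h)%:C * L2dot phi1 psi - (u +i* v) * L2dot phi2 psi.
  by rewrite linearBl -!L2dotZl.
rewrite KE LE; apply/eqP; rewrite eq_complex /= !mul0r !mulr0 !subr0 !addr0 !add0r.
apply/andP; split; apply/eqP.
  rewrite mulrBr mulrA -expr2 hh /u; field.
  by rewrite !gt_eqF.
rewrite /v; field.
by rewrite !gt_eqF.
Qed.

(** In the fiber at [d], vectors with [|f|^2 = h] and [|g|^2 <= 1 - h] attain exactly the points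
    within [sqrt (h (1 - h) d (d - 1))] of [h (1 + d)]. For a suitable [h] this inequality is strict
    at [X + i Y], so it persists when [d] is replaced by a nearby [s]. *)
Lemma ellipse_sub_numerical_range (X Y : R) : (X - c) ^+ 2 / a2 + Y ^+ 2 / b2 < 1 ->
  exists2 x, sqnorm Hdot x = 1 & Hdot (T x) x = X +i* Y.
Proof.
move=> XY; have d1 := d_gt1.
have a0 : 0 < a2 by rewrite /a2; nra.
have b0 : 0 < b2 by rewrite /b2; nra.
have aN := lt0r_neq0 a0; have bN := lt0r_neq0 b0.
(* [h] minimizes [|h (1 + d) - (X + i Y)|^2 - h (1 - h) d (d - 1)]. *)
pose h := (c * X + b2) / (2 * a2).
have F : (h * (1 + d) - X) ^+ 2 + Y ^+ 2 - h * (1 - h) * (d * (d - 1)) < 0.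
  (* The minimum over [h], simplified by [a2 = c^2 + b2]: it is negative exactly inside the
     ellipse. *)
  rewrite (_ : _ - _ = b2 * ((X - c) ^+ 2 / a2 + Y ^+ 2 / b2 - 1)).
    by rewrite pmulr_rlt0// subr_lt0.
  have a2E : 2 * d ^+ 2 + d + 1 != 0 by apply/lt0r_neq0; nra.
  rewrite /h /c /a2 /b2; field.
  by rewrite a2E subr_eq0 !gt_eqF// (lt_trans ltr01).
set N2 := _ + _ ^+ 2 in F.
have N2_ge0 : 0 <= N2 by rewrite addr_ge0 ?sqr_ge0.
have h01 : 0 < h < 1.
  have : 0 < h * (1 - h) by rewrite -(pmulr_lgt0 _ (_ : 0 < d * (d - 1))); nra.
  by move=> h01; apply/andP; split; nra.
(* The margin in the hypothesis of [exists_unit_vector]: continuous in [s] and positive at [d],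
   hence positive just to the left of [d]. *)
pose G s := h * (1 - h) * (s * (s - 1)) -
  (Num.sqrt N2 + h * (d - s)) * (Num.sqrt N2 + h * (d - s)).
have Gd : 0 < G d by rewrite /G subrr mulr0 addr0 -expr2 sqr_sqrtr//; lra.
have cG : G s @[s --> d] --> G d.
  have clin : Num.sqrt N2 + h * (d - s) @[s --> d] --> Num.sqrt N2 + h * (d - d).
    apply: cvgD; first exact: cvg_cst.
    by apply: cvgM; [exact: cvg_cst|apply: cvgB; [exact: cvg_cst|exact: cvg_id]].
  apply: cvgB; last exact: cvgM.
  apply: cvgM; first exact: cvg_cst.
  by apply: cvgM; [exact: cvg_id|apply: cvgB; [exact: cvg_id|exact: cvg_cst]].
near d^'- => s.
apply: (@exists_unit_vector h s) => //.
  by apply/andP; split; near: s; [exact: nbhs_left_gt|exact: nbhs_left_lt].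
rewrite -subr_ge0 expr2 -/N2 -/(G s) ltW//; near: s.
by apply: (cvgr_gt (G d)) => //; exact: cvg_at_left_filter.
Unshelve. all: by end_near. Qed.

End NumericalRange.

Theorem corollary4p15 (R : realType) (r : R) (r_gt1 : 1 < r) :
  let d : R := (r + 1) / 2 in
  let Q : Hspace d -> Hspace d := Qop d in
  let m : Hspace d -> Hspace d := matched_projection Hdot Q in
  let T : Hspace d -> Hspace d := m + (m \o Q) in
  numerical_range Hdot T =
    [set z : R[i] | exists x y : R, z = x +i* y /\
      (x - (r + 3) / 4) ^+ 2 / ((r ^+ 2 + 3 * r + 4) / 8) +
      y ^+ 2 / ((r ^+ 2 - 1) / 16) < 1].
Proof.
move=> d Q m T; have d1 : 1 < d by rewrite /d; lra.
have sT := @has_symbol_T R d.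
have ellE x y : (x - (r + 3) / 4) ^+ 2 / ((r ^+ 2 + 3 * r + 4) / 8) +
    y ^+ 2 / ((r ^+ 2 - 1) / 16) =
    (x - (1 + d) / 2) ^+ 2 / ((2 * d ^+ 2 + d + 1) / 4) + y ^+ 2 / (d * (d - 1) / 4).
  by congr (_ ^+ 2 / _ + _ / _); rewrite /d; field.
rewrite eqEsubset; split=> [_ [x /= x1 <-]|_ [x [y [-> xy]]]].
  have n1 : sqnorm Hdot x = 1.
    by apply: complexI; rewrite -sqnormE -[LHS]sqrtCK -/(hnorm _ x) x1 expr1n.
  exists (complex.Re (Hdot (T x) x)), (complex.Im (Hdot (T x) x)); split.
    by rewrite -[LHS]/(Hdot (T x) x); case: (Hdot (T x) x).
  by rewrite ellE; exact: numerical_range_sub_ellipse.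
rewrite ellE in xy.
have [z z1 zE] := ellipse_sub_numerical_range d1 sT xy.
exists z => //=.
by rewrite /hnorm sqnormE z1 sqrtC1.
Qed.
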